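(* Let $X$ be the Markov mixture process on $\mathbb{S}=E\cup\{\Delta\}$, let $\Gamma_1,\Gamma_2$ be nonempty stochastically closed subsets of $\mathbb{S}$ with $\Gamma_1\cap\Gamma_2=\{\Delta\}$, and let $\tau_l=\inf\{t\ge0:X_t\in\Gamma_l\}$, $l=1,2$. The $\mathcal{F}_{t,i}$-conditional joint Laplace transform $$\Psi_{i,t}(\lambda_1,\lambda_2)=\mathbb{E}\big\{e^{-\lambda_1\tau_1-\lambda_2\tau_2}\,\big|\,\mathcal{F}_{t,i}\big\}$$ of the first exit times $\tau_1$ and $\tau_2$ of $X$ is given for $\lambda_1,\lambda_2\ge0$, $t\ge0$ and $i\in E$ by $$\begin{aligned}\Psi_{i,t}(\lambda_1,\lambda_2)=&\sum_{k=1}^m\mathbf{e}_i^{\top}\mathbf{S}^{(k)}(t)\big((\lambda_1+\lambda_2)\mathbf{I}-\mathbf{B}^{(k)}\big)^{-1}\Big([\mathbf{B}^{(k)},\mathbf{H}_2]\big(\lambda_1\mathbf{I}-\mathbf{B}^{(k)}\big)^{-1}\mathbf{B}^{(k)}\mathbf{H}_1\\&+[\mathbf{B}^{(k)},\mathbf{H}_1]\big(\lambda_2\mathbf{I}-\mathbf{B}^{(k)}\big)^{-1}\mathbf{B}^{(k)}\mathbf{H}_2+[\mathbf{B}^{(k)},\mathbf{H}_2]\mathbf{H}_1+[\mathbf{B}^{(k)},\mathbf{H}_1]\mathbf{H}_2-\mathbf{B}^{(k)}\mathbf{H}_2\mathbf{H}_1\Big)\mathbb{1}\\&+\big(1-\mathbf{e}_i^{\top}\mathbf{H}_2\mathbf{H}_1\mathbb{1}\big),\end{aligned}$$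 where $[A,B]=AB-BA$ is the commutator.
   Context: Mixture process: $E=\{1,\dots,n\}$ are the transient states, $\Delta=n+1$ is the absorbing state, $\mathbb{S}=E\cup\{\Delta\}$. $X^{(1)},\dots,X^{(m)}$ are Markov jump processes on $\mathbb{S}$ with right-continuous sample paths and intensity matrices $\mathbf{Q}^{(k)}=\begin{pmatrix}\mathbf{B}^{(k)}&-\mathbf{B}^{(k)}\mathbb{1}\\ \mathbf{0}&0\end{pmatrix}$ (nonnegative off-diagonal entries, zero row sums), with $\mathbf{B}^{(k)}$ an $n\times n$ nonsingular matrix. The mixture process $X$ equals $X^{(k)}$ when $\phi=k$, where $\phi\in\{1,\dots,m\}$ is an unobservable speed regime. The initial law is $\mathbb{P}\{X_0=i\}=\pi_i$ for $i\in E$ and $\mathbb{P}\{X_0=\Delta\}=0$; $\mathbb{P}\{\phi=k\mid X_0=i\}=s_i^{(k)}$ with $\sum_{k=1}^m s_i^{(k)}=1$. Closed sets: $\Gamma_l$ is stochastically closed if $X$ never leaves it once it has entered; hence $[\mathbf{Q}^{(k)}]_{i,j}=0$ for all $k$ if $i\in\Gamma_l$ and $j\in\Gamma_l^c$. It is assumed that $\pi_i\ne0$ if $i\in\Gamma_1^c\cap\Gamma_2^c$, and that $\mathbb{P}\{\tau_1>0,\tau_2>0\}=1$. $\mathbf{H}_l$ is the $n\times n$ diagonal matrix whose $i$th diagonal element, $i\in E$, is $1$ if $i\in\Gamma_l^c$ and $0$ otherwise. Information: $\mathcal{F}_{t-}$ denotes the available previous information about $X$ prior to time $t$ (full, partial,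 or nothing); $\mathcal{F}_{t,i}=\mathcal{F}_{t-}\cup\{X_t=i\}$ is this information together with the observation $X_t=i$. Notation: $\mathbf{S}^{(k)}(t)=\mathrm{diag}(s_1^{(k)}(t),\dots,s_n^{(k)}(t))$ with $s_i^{(k)}(t)=\mathbb{P}\{\phi=k\mid\mathcal{F}_{t,i}\}$, so $\sum_{k=1}^m\mathbf{S}^{(k)}(t)=\mathbf{I}$, the identity matrix; $\mathbf{e}_i$ is the $i$th unit vector, $\mathbb{1}$ the all-ones vector.
   Formalization: As printed the formula fails for t>0 (no factor e^{-(λ1+λ2)t}); here τ_l is counted from t, as τ_l−t, the formula is proved when both exits exceed t (it fails for t>0, i∈Γ1∪Γ2), and for all i with the exponential replaced by 1 off {τ1>t,τ2>t}; X^(k) is Markov given φ=k. *)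

(* Defs.v *)
From HB Require Import structures.
From mathcomp Require Import all_boot all_order all_algebra.
From mathcomp Require Import all_classical all_reals all_analysis.

Set Implicit Arguments.
Unset Strict Implicit.
Unset Printing Implicit Defensive.

Import Order.TTheory GRing.Theory Num.Theory.
Import numFieldNormedType.Exports.

Local Open Scope classical_set_scope.
Local Open Scope ring_scope.

(* The state space E u {Delta} is 'I_(n + 1): E is the image of lshift 1, and
   Delta is rshift n ord0. This is the indexing of block_mx. *)
Definition transient (n : nat) (i : 'I_n) : 'I_(n + 1) := lshift 1 i.
Definition absorbing (n : nat) : 'I_(n + 1) := rshift n ord0.

Section Matrices.
Context {R : realType}.

Definition commutator (n : nat) (A B : 'M[R]_n) : 'M[R]_n := A *m B - B *m A.

Definition expmx (n : nat) (A : 'M[R]_n) : 'M[R]_n :=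
  \matrix_(i, j)
    limn (fun N => \sum_(0 <= k < N) (k`!%:R)^-1 * (iter k (mulmx A) 1%:M) i j).

Definition intensity_matrix (n : nat) (Q : 'M[R]_n) : Prop :=
  (forall i j, i != j -> 0 <= Q i j) /\ (forall i, \sum_j Q i j = 0).

Definition generator (n : nat) (B : 'M[R]_n) : 'M[R]_(n + 1) :=
  block_mx B (- (B *m const_mx 1)) 0 0.

(* H_l, for Gamma = Gamma_l *)
Definition outside_mx (n : nat) (Gamma : {set 'I_(n + 1)}) : 'M[R]_n :=
  diag_mx (\row_i (transient i \notin Gamma)%:R).

End Matrices.

Section Processes.
Context {d : measure_display} {T : measurableType d} {R : realType}.

(* A process is indexed by R; only its values at nonnegative times matter. *)

Definition event_at {S : Type} (X : R -> T -> S) (t : R) (x : S) : set T :=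
  [set w | X t w = x].

Definition history {S : Type} (X : R -> T -> S) (t : R) : set_system T :=
  <<s [set A | exists u x, 0 <= u <= t /\ A = event_at X u x] >>.

(* Trivial when t = 0. *)
Definition strict_history {S : Type} (X : R -> T -> S) (t : R) : set_system T :=
  <<s [set A | exists u x, 0 <= u < t /\ A = event_at X u x] >>.

(* Under P( . | D), the process X is a Markov jump process with right-continuous
   paths and intensity matrix Q: the Markov property with respect to the natural
   filtration, with transition matrices exp ((u - s) Q), multiplied out by the
   probabilities of the conditioning events, so that null events are harmless. *)
Definition markov_jump_process (P : probability T R) (D : set T) (n : nat)
    (X : R -> T -> 'I_n) (Q : 'M[R]_n) : Prop :=
  [/\ intensity_matrix Q,
      forall t x, 0 <= t -> measurable (event_at X t x),
      forall t w, 0 <= t -> \forall u \near t^'+, X u w = X t w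
    & forall (s u : R) (x y : 'I_n) (A : set T),
        0 <= s -> s <= u -> history X s A ->
        P (D `&` A `&` event_at X s x `&` event_at X u y) =
        (P (D `&` A `&` event_at X s x) * (expmx ((u - s) *: Q) x y)%:E)%E].

Definition regime {m : nat} (phi : T -> 'I_m) (k : 'I_m) : set T :=
  [set w | phi w = k].

Definition mixture {S : Type} {m : nat} (phi : T -> 'I_m)
    (Xk : 'I_m -> R -> T -> S) : R -> T -> S :=
  fun t w => Xk (phi w) t w.

(* The regime phi depends on X only through X_0: this is expressed by asking
   that X^(k) be a Markov jump process conditionally on phi = k. *)
Record markov_mixture (P : probability T R) (n m : nat)
    (B : 'I_m -> 'M[R]_n) (pi : 'I_n -> R) (s0 : 'I_m -> 'I_n -> R)
    (phi : T -> 'I_m) (Xk : 'I_m -> R -> T -> 'I_(n + 1)) : Prop := {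
  mixture_nonsingular : forall k, B k \in unitmx;
  mixture_regime_measurable : forall k, measurable (regime phi k);
  mixture_markov : forall k,
    markov_jump_process P (regime phi k) (Xk k) (generator (B k));
  mixture_initial : forall i,
    P (event_at (mixture phi Xk) 0 (transient i)) = (pi i)%:E;
  mixture_initial_absorbing :
    P (event_at (mixture phi Xk) 0 (absorbing n)) = 0%E;
  mixture_s0_ge0 : forall k i, 0 <= s0 k i;
  mixture_s0_sum : forall i, \sum_k s0 k i = 1;
  mixture_initial_regime : forall k i,
    P (regime phi k `&` event_at (mixture phi Xk) 0 (transient i)) =
    (s0 k i * pi i)%:E
}.

(* Almost surely, once entered, Gamma is never left; the second conjunct is the resulting condition
   on the generators, required in every regime, visited or not. *)
Definition stochastically_closed (P : probability T R) (n m : nat)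
    (B : 'I_m -> 'M[R]_n) (X : R -> T -> 'I_(n + 1))
    (Gamma : {set 'I_(n + 1)}) : Prop :=
  {ae P, forall w, forall s t : R, 0 <= s -> s <= t ->
     X s w \in Gamma -> X t w \in Gamma} /\
  (forall k i j, i \in Gamma -> j \notin Gamma -> generator (B k) i j = 0).

(* inf {t >= 0 : X_t \in Gamma}, with value +oo if Gamma is never entered *)
Definition exit_time (n : nat) (X : R -> T -> 'I_n) (Gamma : {set 'I_n})
    (w : T) : \bar R :=
  ereal_inf [set t%:E | t in [set t : R | 0 <= t /\ X t w \in Gamma]].

(* Z is a version of the conditional expectation of Y given the information G
   together with the observation that D occurred, i.e. of the conditional
   expectation of Y given the sigma-algebra G under P( . | D). It is determined
   up to P( . | D)-null sets. *)
Definition cond_expectation (P : probability T R) (G : set_system T)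
    (D : set T) (Y : T -> \bar R) (Z : T -> R) : Prop :=
  [/\ P.-integrable D Y,
      preimage_set_system setT Z measurable `<=` G,
      P.-integrable D (EFin \o Z)
    & forall A, G A ->
        (\int[P]_(w in A `&` D) Y w = \int[P]_(w in A `&` D) (Z w)%:E)%E].

(* The exponent of the joint Laplace transform, with tau_1 and tau_2 counted
   from the observation time t. *)
Definition laplace_exp (t l1 l2 : R) (tau1 tau2 : T -> \bar R) (w : T) : \bar R :=
  expeR (- (l1%:E * (tau1 w - t%:E) + l2%:E * (tau2 w - t%:E)))%E.

(* Neither exit has occurred by time t. *)
Definition both_pending (t : R) (tau1 tau2 : T -> \bar R) (w : T) : bool :=
  ((t%:E < tau1 w) && (t%:E < tau2 w))%E.

End Processes.

(* The closed form, with Ss k playing the role of S^(k)(t) and Hl of H_l. *)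
Definition laplace_formula {R : realType} (n m : nat) (B Ss : 'I_m -> 'M[R]_n)
    (H1 H2 : 'M[R]_n) (l1 l2 : R) (i : 'I_n) : R :=
  let e : 'rV[R]_n := delta_mx 0 i in
  let one : 'cV[R]_n := const_mx 1 in
  (\sum_(k < m)
     e *m Ss k *m invmx ((l1 + l2)%:M - B k) *m
     (commutator (B k) H2 *m invmx (l1%:M - B k) *m B k *m H1
      + commutator (B k) H1 *m invmx (l2%:M - B k) *m B k *m H2
      + commutator (B k) H2 *m H1
      + commutator (B k) H1 *m H2
      - B k *m H2 *m H1) *m one) 0 0
  + (1 - (e *m H2 *m H1 *m one) 0 0).

(* Main.v *)
(* Put Y_s = exp (- l1 (tau_1 - s)^+ - l2 (tau_2 - s)^+), and let r be l1 times
   the indicator of the complement of Gamma_1 plus l2 times that of Gamma_2. In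
   regime k the closed form extends to a function F on all states, equal to 1
   where r vanishes, which solves the Feynman-Kac equation Q F = r F. If D is an
   event of the past of s with X_s = x and phi = k, the error
   E [Y_s ; D] - P (D) F x is at most K P (D) for some constant K uniform in s, x
   and D. Splitting D according to X_(s + h) and using
   exp (h Q) = 1 + h Q + O (h^2), the bound K can be replaced by
   exp (- rho h) K + C h^2 for every h in [0, 1], with rho > 0 the least positive
   value of r; so the best bound is 0. Summing over the regimes, weighted by
   s^(k), gives the conditional expectation. *)

(* Neither the jump times nor the laws of the exit times enter: the path is compared only at the two
   times s and s + h. Closedness makes this enough. A path found in x at both times has not, almost
   surely, visited in between a closed set that omits x, so its discount over the step is known
   exactly whatever it did meanwhile. A path that changed state is discounted wrongly by O (h), but
   such paths have probability O (h). The loss per step is therefore O (h^2), against a contraction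
   gain of order h, and small h wins. States where r vanishes offer no contraction; there Y_s and F
   are both 1 and the error is exactly 0.

   On the algebraic side, the commutators of the closed form are the boundary terms of a Dirichlet
   problem on the states outside both sets. The values of F inside one of the sets are transforms of
   the exit still pending; they are needed to propagate the error, although the formula of the
   theorem is 1 there. *)
Require Import Defs.
From mathcomp Require Import all_boot all_order all_algebra.
From mathcomp Require Import all_classical all_reals all_analysis.
From mathcomp Require Import measurable_realfun.
From mathcomp Require Import ring lra.

Set Implicit Arguments.
Unset Strict Implicit.
Unset Printing Implicit Defensive.

Import Order.TTheory GRing.Theory Num.Theory.
Import numFieldNormedType.Exports.

Local Open Scope classical_set_scope.
Local Open Scope ring_scope.

(** * Closed form *)

(* The row space of K is stable under M, hence, by dimension, under its inverse. *)
Lemma invmx_stable (F : fieldType) (n : nat) (K M : 'M[F]_n) :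
  M \in unitmx -> K *m K = K -> K *m M *m K = K *m M ->
  K *m invmx M *m K = K *m invmx M.
Proof.
move=> uM KK KMK.
have sub : (K *m M <= K)%MS by rewrite -KMK submxMl.
have : (K <= K *m M)%MS.
  by rewrite -(geq_leqif (mxrank_leqif_sup sub)) mxrankMfree // row_free_unit.
case/submxP=> Z eqK.
have -> : K *m invmx M = Z *m K.
  by rewrite {1}eqK -mulmxA -[K *m M *m _]mulmxA mulmxV // mulmx1.
by rewrite -mulmxA KK.
Qed.

(** Maximum principle: for l > 0 and a kernel vector v of l - B, the row of an index i maximizing |v
    i| gives l |v i| <= (sum_j B i j) |v i| <= 0. The case l = 0 is the nonsingularity of B
    itself. *)
Lemma resolvent_unitmx (R : realFieldType) (n : nat) (B : 'M[R]_n) (l : R) :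
  (forall i j, i != j -> 0 <= B i j) -> (forall i, \sum_j B i j <= 0) ->
  B \in unitmx -> 0 <= l -> l%:M - B \in unitmx.
Proof.
move=> B_ge0 B_sum uB; rewrite le_eqVlt => /predU1P[<-|l_gt0].
  by rewrite raddf0 sub0r -scaleN1r unitmxZ ?unitrN1.
rewrite -unitmx_tr unitmxE unitfE; apply/det0P => -[u u_neq0 uM].
pose v j := u ord0 j.
have eqv i : \sum_j B i j * v j = l * v i.
  move/rowP/(_ i): uM; rewrite linearB /= tr_scalar_mx mulmxBr mul_mx_scalar.
  rewrite !mxE => /eqP; rewrite subr_eq0 => /eqP ->.
  by apply: eq_bigr => j _; rewrite mxE mulrC.
have [i0 vi0] : exists i, v i != 0.
  apply/existsP; apply: contraR u_neq0 => /existsPn v0; apply/eqP/rowP => j.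
  by rewrite mxE; apply/eqP; move: (v0 j); rewrite negbK.
pose i := [arg max_(i > i0) `|v i|]%O.
have imax j : `|v j| <= `|v i|.
  by rewrite /i; case: arg_maxP => // k _; apply.
have vi_gt0 : 0 < `|v i| by apply: lt_le_trans (imax i0); rewrite normr_gt0.
have /(congr1 (fun z => Num.sg (v i) * z)) := eqv i.
rewrite mulrCA -normrEsg mulr_sumr => eqs.
have : 0 < l * `|v i| by rewrite mulr_gt0.
rewrite -eqs ltNge => /negP; apply.
apply: (@le_trans _ _ (\sum_j B i j * `|v i|)); last first.
  by rewrite -mulr_suml; apply: mulr_le0_ge0.
apply: ler_sum => j _; rewrite mulrCA.
have [<-|nij] := eqVneq i j; first by rewrite -normrEsg.
apply: ler_wpM2l; first exact: B_ge0.
apply: le_trans (imax j); apply: le_trans (ler_norm _) _.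
rewrite normrM ler_piMl //.
by rewrite normr_sg; case: (v i != 0).
Qed.

Section ClosedForm.
Context {R : realType} {n : nat}.
Context (B K1 K2 : 'M[R]_n) (l1 l2 : R).

Let H1 : 'M[R]_n := 1%:M - K1.
Let H2 : 'M[R]_n := 1%:M - K2.
Let one : 'cV[R]_n := const_mx 1.

(* With H the indicator of the complement of Gamma, the i-th entry is the
   expectation of 1 - exp (- l tau) from state i, tau being the entry time of
   Gamma. *)
Definition exit_deficit (l : R) (H : 'M[R]_n) : 'cV[R]_n :=
  l *: (invmx (l%:M - B) *m (H *m one)).

(** For indicators K1, K2 of disjoint closed sets, with deficits v1, v2, this is the part outside
    both sets of - B 1 + B K1 (1 - v2) + B K2 (1 - v1): the value brought in by jumps to Delta,
    Gamma_1 and Gamma_2. Commutators instead of the bare products - B K2 v1 and - B K1 v2 cancel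
    what would remain inside the sets. *)
Definition killed_source : 'cV[R]_n :=
  commutator B H2 *m exit_deficit l1 H1 + commutator B H1 *m exit_deficit l2 H2
  - B *m (H2 *m (H1 *m one)).

Definition killed_solution : 'cV[R]_n :=
  invmx ((l1 + l2)%:M - B) *m killed_source.

(* On Gamma_1, whose indicator is K1, only tau_2 is left to wait for. *)
Definition laplace_vector : 'cV[R]_n :=
  killed_solution + K1 *m (one - exit_deficit l2 H2)
  + K2 *m (one - exit_deficit l1 H1).

Lemma resolvent_deficit (l : R) (H : 'M[R]_n) : l%:M - B \in unitmx ->
  (invmx (l%:M - B) *m B *m H + H) *m one = exit_deficit l H.
Proof.
move=> uM; rewrite /exit_deficit.
have -> : invmx (l%:M - B) *m B = l *: invmx (l%:M - B) - 1%:M.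
  rewrite -[X in _ *m X](subKr l%:M) mulmxBr mulVmx // mul_mx_scalar.
  by [].
by rewrite mulmxBl mul1mx subrK mulmxA -!scalemxAl.
Qed.

(** Each commutator occurs twice, with and without a resolvent; by [resolvent_deficit] the two terms
    together apply it to a single deficit. *)
Lemma laplace_source_eq :
  l1%:M - B \in unitmx -> l2%:M - B \in unitmx ->
  (commutator B H2 *m invmx (l1%:M - B) *m B *m H1
   + commutator B H1 *m invmx (l2%:M - B) *m B *m H2
   + commutator B H2 *m H1 + commutator B H1 *m H2 - B *m H2 *m H1) *m one
  = killed_source.
Proof.
move=> u1 u2; rewrite /killed_source -!resolvent_deficit // !mulmxA.
rewrite [LHS]mulmxBl -!mulmxDl; congr (_ *m _ - _); clearbody H1 H2.
rewrite !mulmxDr !mulmxA -!addrA; congr (_ + _).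
by rewrite addrCA.
Qed.

Context (KK1 : K1 *m K1 = K1) (KK2 : K2 *m K2 = K2).
Context (K12 : K1 *m K2 = 0) (K21 : K2 *m K1 = 0).
Context (KB1 : K1 *m B *m K1 = K1 *m B) (KB2 : K2 *m B *m K2 = K2 *m B).
Context (u1 : l1%:M - B \in unitmx) (u2 : l2%:M - B \in unitmx).
Context (u12 : (l1 + l2)%:M - B \in unitmx).

Lemma stable_resolvent (K : 'M[R]_n) (l : R) :
  l%:M - B \in unitmx -> K *m K = K -> K *m B *m K = K *m B ->
  K *m invmx (l%:M - B) *m K = K *m invmx (l%:M - B).
Proof.
move=> uM KK KB; apply: invmx_stable => //.
by rewrite !mulmxBr mulmxBl KB mul_mx_scalar -scalemxAl KK.
Qed.

Lemma generator_deficit (l : R) (H : 'M[R]_n) : l%:M - B \in unitmx ->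
  B *m exit_deficit l H = l *: exit_deficit l H - l *: (H *m one).
Proof.
move=> uM; have : (l%:M - B) *m exit_deficit l H = l *: (H *m one).
  by rewrite /exit_deficit -scalemxAr mulKVmx.
by move=> <-; rewrite mulmxBl mul_scalar_mx subKr.
Qed.

Lemma commutator_compl (K : 'M[R]_n) :
  commutator B (1%:M - K) = K *m B - B *m K.
Proof.
rewrite /commutator mulmxBr mulmxBl mulmx1 mul1mx opprB addrC addrA subrK.
by [].
Qed.

(** Stability passes to the resolvent, so it is enough that K1 and K2 kill the source: K (K B - B K)
    = 0 by stability, and the mixed terms vanish because the sets are disjoint. *)
Lemma killed_solution_closed :
  K1 *m killed_solution = 0 /\ K2 *m killed_solution = 0.
Proof.
have kill K : K *m K = K -> K *m B *m K = K *m B ->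
    K *m killed_source = 0 -> K *m killed_solution = 0.
  move=> KK KB Kc; rewrite /killed_solution mulmxA -(stable_resolvent u12 KK KB).
  by rewrite -mulmxA Kc mulmx0.
have KBK1 : K1 *m B *m K2 = 0 by rewrite -KB1 -mulmxA K12 mulmx0.
have KBK2 : K2 *m B *m K1 = 0 by rewrite -KB2 -mulmxA K21 mulmx0.
have source K K' (l l' : R) :
    K *m K = K -> K *m K' = 0 -> K *m B *m K = K *m B -> K *m B *m K' = 0 ->
    K *m (commutator B (1%:M - K') *m exit_deficit l (1%:M - K)
      + commutator B (1%:M - K) *m exit_deficit l' (1%:M - K')) = 0.
  move=> KK KK' KB KBK'; rewrite mulmxDr !mulmxA !commutator_compl.
  by rewrite !mulmxBr !mulmxA KBK' KK' KK KB mul0mx !subrr !mul0mx addr0.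
split; apply: kill => //; rewrite /killed_source mulmxBr.
- rewrite source // sub0r !mulmxA /H1 /H2 [_ *m (1%:M - K2)]mulmxBr.
  by rewrite mulmx1 KBK1 subr0 mulmxBr mulmx1 KB1 subrr mul0mx oppr0.
- rewrite [X in K2 *m X - _]addrC source // sub0r !mulmxA /H1 /H2.
  by rewrite [_ *m (1%:M - K2)]mulmxBr mulmx1 KB2 subrr !mul0mx oppr0.
Qed.

Lemma mul_laplace_vector :
  K1 *m laplace_vector = K1 *m (one - exit_deficit l2 H2) /\
  K2 *m laplace_vector = K2 *m (one - exit_deficit l1 H1).
Proof.
have [Kw1 Kw2] := killed_solution_closed.
split; rewrite /laplace_vector 2!mulmxDr ?Kw1 ?Kw2 add0r !mulmxA.
- by rewrite KK1 K12 mul0mx addr0.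
- by rewrite KK2 K21 mul0mx add0r.
Qed.

(** Subtracting [one] accounts for jumps to Delta, whose rates are - B 1 and where the solution is
    1. The identity splits over Gamma_1, Gamma_2 and the states outside both; inside one set only
    the other rate acts, and the equation is that of a single deficit. *)
Lemma laplace_vector_harmonic :
  B *m (laplace_vector - one)
  = l1 *: (H1 *m laplace_vector) + l2 *: (H2 *m laplace_vector).
Proof.
have [KF1 KF2] := mul_laplace_vector.
have [Kw1 Kw2] := killed_solution_closed.
have Bv1 := generator_deficit H1 u1.
have Bv2 := generator_deficit H2 u2.
pose P : 'M[R]_n := 1%:M - K1 - K2.
have PK1 : P *m K1 = 0 by rewrite /P !mulmxBl mul1mx KK1 K21 subrr subr0.
have PK2 : P *m K2 = 0 by rewrite /P !mulmxBl mul1mx KK2 K12 subr0 subrr.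
have decomp (x y : 'cV[R]_n) :
    K1 *m x = K1 *m y -> K2 *m x = K2 *m y -> P *m x = P *m y -> x = y.
  move=> e1 e2; rewrite /P !mulmxBl !mul1mx e1 e2.
  by move/(congr1 (fun z => z + K2 *m y + K1 *m y)); rewrite !subrK.
have HE1 : H1 *m laplace_vector = laplace_vector - K1 *m laplace_vector.
  by rewrite mulmxBl mul1mx.
have HE2 : H2 *m laplace_vector = laplace_vector - K2 *m laplace_vector.
  by rewrite mulmxBl mul1mx.
have KH1 : K1 *m H1 = 0 by rewrite mulmxBr mulmx1 KK1 subrr.
have KH2 : K2 *m H2 = 0 by rewrite mulmxBr mulmx1 KK2 subrr.
have KH12 : K1 *m H2 = K1 by rewrite mulmxBr mulmx1 K12 subr0.
have KH21 : K2 *m H1 = K2 by rewrite mulmxBr mulmx1 K21 subr0.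
have subK (x : 'cV[R]_n) : one - x - one = - x by rewrite addrAC subrr add0r.
apply: decomp.
- rewrite [RHS]mulmxDr -!scalemxAr !mulmxA KH1 KH12 mul0mx scaler0 add0r KF1.
  rewrite -KB1 -(mulmxA _ K1) [K1 *m (laplace_vector - _)]mulmxBr KF1 -mulmxBr.
  rewrite subK mulmxA KB1 mulmxN -mulmxA Bv2. rewrite -scalerBr -scalemxAr -scalerN.
  by rewrite mulmxBr mulmxA KH12 opprB -mulmxBr.
- rewrite [RHS]mulmxDr -!scalemxAr !mulmxA KH2 KH21 mul0mx scaler0 addr0 KF2.
  rewrite -KB2 -(mulmxA _ K2) [K2 *m (laplace_vector - _)]mulmxBr KF2 -mulmxBr.
  rewrite subK mulmxA KB2 mulmxN -mulmxA Bv1 -scalerBr -scalemxAr -scalerN.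
  by rewrite mulmxBr mulmxA KH21 opprB -mulmxBr.
(* Outside both sets both rates act. The resolvent equation leaves minus the source, which cancels
   against the jumps into Gamma_1, Gamma_2 and Delta. *)
- have Bw : B *m killed_solution
      = (l1 + l2) *: killed_solution - killed_source.
    rewrite -[X in _ - X](mulKVmx u12 killed_source) -/killed_solution.
    by rewrite mulmxBl mul_scalar_mx subKr.
  have Pw : P *m killed_solution = killed_solution.
    by rewrite !mulmxBl mul1mx Kw1 Kw2 !subr0.
  have PF : P *m laplace_vector = killed_solution.
    by rewrite /laplace_vector 2!mulmxDr Pw !mulmxA PK1 PK2 !mul0mx !addr0.
  have -> : P *m (l1 *: (H1 *m laplace_vector) + l2 *: (H2 *m laplace_vector))
      = (l1 + l2) *: killed_solution.
    rewrite HE1 HE2 mulmxDr -!scalemxAr !(mulmxBr P) !(mulmxA P) PK1 PK2.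
    by rewrite !mul0mx !subr0 PF scalerDl.
  have -> : B *m (laplace_vector - one) = B *m killed_solution
      + B *m (K1 *m (one - exit_deficit l2 H2))
      + B *m (K2 *m (one - exit_deficit l1 H1)) - B *m one.
    by rewrite mulmxBr /laplace_vector 2!mulmxDr.
  rewrite mulmxBr 2!mulmxDr Bw [P *m (_ - killed_source)]mulmxBr.
  rewrite -scalemxAr Pw /killed_source !commutator_compl.
  move: (exit_deficit l1 H1) (exit_deficit l2 H2) => v1 v2.
  rewrite (_ : H2 *m (H1 *m one) = one - K1 *m one - K2 *m one); last first.
    rewrite [H1 *m one]mulmxBl mul1mx [LHS]mulmxBl mul1mx mulmxBr mulmxA K21.
    by rewrite mul0mx subr0.
  clear HE1 HE2 Pw PF Bw; clearbody P. 
  rewrite !(mulmxBr, mulmxDr, mulmxBl, mulmxN) !mulmxA PK1 PK2 !mul0mx !sub0r.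
  move: (P *m B *m K1 *m one) (P *m B *m K2 *m one) (P *m B *m one).
  move: (P *m B *m K1 *m v2) (P *m B *m K2 *m v1).
  move=> a b c e f; apply/matrixP => i j; rewrite !mxE; ring.
Qed.

End ClosedForm.

(** * Feynman-Kac equation on the full state space *)

Definition discount_rate (R : realType) (N : nat) (Gamma1 Gamma2 : {set 'I_N})
    (l1 l2 : R) (x : 'I_N) : R :=
  l1 * (x \notin Gamma1)%:R + l2 * (x \notin Gamma2)%:R.

Section GeneratorForm.
Context {R : realType} {n : nat}.
Context (B : 'M[R]_n) (Gamma1 Gamma2 : {set 'I_(n + 1)}) (l1 l2 : R).
Context (uB : B \in unitmx) (iQ : intensity_matrix (generator B)).
Context (cl1 : forall i j, i \in Gamma1 -> j \notin Gamma1 -> generator B i j = 0).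
Context (cl2 : forall i j, i \in Gamma2 -> j \notin Gamma2 -> generator B i j = 0).
Context (cap : Gamma1 :&: Gamma2 = [set absorbing n]%SET).
Context (l1_ge0 : 0 <= l1) (l2_ge0 : 0 <= l2).

Definition inside_mx (Gamma : {set 'I_(n + 1)}) : 'M[R]_n :=
  diag_mx (\row_i (transient i \in Gamma)%:R).

Lemma outside_mxE (Gamma : {set 'I_(n + 1)}) :
  outside_mx Gamma = 1%:M - inside_mx Gamma.
Proof.
apply/matrixP => i j; rewrite !mxE.
by case: eqVneq => _; case: (transient i \in Gamma);
  rewrite /= ?mulr1n ?mulr0n ?subrr ?subr0.
Qed.

Lemma inside_mul (Gamma : {set 'I_(n + 1)}) (v : 'cV[R]_n) i j :
  (inside_mx Gamma *m v) i j = (transient i \in Gamma)%:R * v i j.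
Proof. by rewrite mul_diag_mx !mxE. Qed.

Lemma outside_mul (Gamma : {set 'I_(n + 1)}) (v : 'cV[R]_n) i j :
  (outside_mx Gamma *m v) i j = (transient i \notin Gamma)%:R * v i j.
Proof. by rewrite mul_diag_mx !mxE. Qed.

Lemma inside_idem (Gamma : {set 'I_(n + 1)}) :
  inside_mx Gamma *m inside_mx Gamma = inside_mx Gamma.
Proof.
rewrite mulmx_diag; congr diag_mx; apply/rowP => i; rewrite !mxE.
by case: (_ \in _); rewrite ?mulr1 ?mulr0.
Qed.

Lemma generatorE (i j : 'I_n) : generator B (transient i) (transient j) = B i j.
Proof. by rewrite block_mxEul. Qed.

Lemma inside_stable (Gamma : {set 'I_(n + 1)}) :
  (forall i j, i \in Gamma -> j \notin Gamma -> generator B i j = 0) ->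
  inside_mx Gamma *m B *m inside_mx Gamma = inside_mx Gamma *m B.
Proof.
move=> cl; apply/matrixP => i j; rewrite mul_mx_diag mul_diag_mx !mxE.
case iG: (transient i \in Gamma); rewrite ?mul0r // mul1r.
have [jG|jG] := boolP (transient j \in Gamma); first by rewrite mulr1.
by rewrite mulr0 -generatorE cl // iG.
Qed.

Lemma transient_disjoint i :
  transient i \in Gamma1 -> transient i \in Gamma2 -> False.
Proof.
move=> i1 i2; have : transient i \in Gamma1 :&: Gamma2 by rewrite finset.in_setI i1.
rewrite cap finset.in_set1 => /eqP/(congr1 val) /= E.
by move: (ltn_ord i); rewrite E addn0 ltnn.
Qed.

Lemma absorbing_in : (absorbing n \in Gamma1) * (absorbing n \in Gamma2).
Proof.
have : absorbing n \in Gamma1 :&: Gamma2 by rewrite cap finset.in_set1.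
by rewrite finset.in_setI => /andP[-> ->].
Qed.

Lemma inside_mul0 :
  inside_mx Gamma1 *m inside_mx Gamma2 = 0 /\
  inside_mx Gamma2 *m inside_mx Gamma1 = 0.
Proof.
have disj i : (transient i \in Gamma1) && (transient i \in Gamma2) = false.
  by apply/negP => /andP[]; exact: transient_disjoint.
rewrite !mulmx_diag; split; apply/matrixP => i j; rewrite !mxE -natrM mulnb.
- by rewrite disj mul0rn.
- by rewrite andbC disj mul0rn.
Qed.

Lemma killed_resolvent_unitmx (l : R) : 0 <= l -> l%:M - B \in unitmx.
Proof.
case: iQ => Q_ge0 Q_sum; apply: resolvent_unitmx => // [i j nij|i].
  rewrite -generatorE; apply: Q_ge0; apply: contra nij.
  by move=> /eqP/lshift_inj/eqP.
have /eqP := Q_sum (transient i); rewrite big_split_ord /= big_ord1.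
under eq_bigr do rewrite generatorE.
rewrite addr_eq0 => /eqP ->; rewrite oppr_le0.
apply: Q_ge0; rewrite eq_lrshift; done.
Qed.

Definition joint_laplace : 'cV[R]_(n + 1) :=
  col_mx (laplace_vector B (inside_mx Gamma1) (inside_mx Gamma2) l1 l2) (const_mx 1).

Lemma joint_laplace_harmonic x :
  \sum_y generator B x y * joint_laplace y 0
  = discount_rate Gamma1 Gamma2 l1 l2 x * joint_laplace x 0.
Proof.
have [K12 K21] := inside_mul0.
have := laplace_vector_harmonic (inside_idem Gamma1) (inside_idem Gamma2) K12 K21
  (inside_stable cl1) (inside_stable cl2) (killed_resolvent_unitmx l1_ge0)
  (killed_resolvent_unitmx l2_ge0) (killed_resolvent_unitmx (addr_ge0 l1_ge0 l2_ge0)).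
rewrite /joint_laplace; set F := laplace_vector _ _ _ _ _ => eqF.
have -> : \sum_y generator B x y * (col_mx F (const_mx 1)) y 0
    = (generator B *m col_mx F (const_mx 1)) x 0 by rewrite mxE.
rewrite /generator mul_block_col !mul0mx addr0.
have -> : B *m F + - (B *m const_mx 1) *m (const_mx 1 : 'cV_1) = B *m (F - const_mx 1).
  rewrite mulmxBr mulNmx -mulmxA; congr (_ - _ *m _).
  by apply/matrixP => i j; rewrite !mxE big_ord1 !mxE mulr1.
rewrite eqF /discount_rate; case: (split_ordP x) => i ->; rewrite ?col_mxEu ?col_mxEd.
  rewrite -!outside_mxE [LHS]mxE [X in X + _ = _]mxE [X in _ + X = _]mxE !outside_mul.
  rewrite /transient; ring.
rewrite ord1 -/(absorbing n) !absorbing_in /= !mulr0 addr0 mul0r.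
by rewrite mxE.
Qed.

Lemma killed_solution_inside :
  inside_mx Gamma1 *m killed_solution B (inside_mx Gamma1) (inside_mx Gamma2) l1 l2 = 0
  /\ inside_mx Gamma2 *m killed_solution B (inside_mx Gamma1) (inside_mx Gamma2) l1 l2 = 0.
Proof.
have [K12 K21] := inside_mul0.
apply: killed_solution_closed; rewrite ?K12 ?K21 //; try exact: inside_idem;
  try exact: inside_stable; apply: killed_resolvent_unitmx => //.
exact: addr_ge0.
Qed.

Lemma killed_solution_eq0 i : (transient i \in Gamma1) || (transient i \in Gamma2) ->
  killed_solution B (inside_mx Gamma1) (inside_mx Gamma2) l1 l2 i 0 = 0.
Proof.
have [/matrixP/(_ i 0) e1 /matrixP/(_ i 0) e2] := killed_solution_inside.
move: e1 e2; rewrite !inside_mul !mxE.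
by case: (_ \in Gamma1); case: (_ \in Gamma2); rewrite // ?mul1r.
Qed.

Lemma joint_laplace_transient i : joint_laplace (transient i) 0 =
  killed_solution B (inside_mx Gamma1) (inside_mx Gamma2) l1 l2 i 0
  + (transient i \in Gamma1)%:R
    * (1 - exit_deficit B l2 (1%:M - inside_mx Gamma2) i 0)
  + (transient i \in Gamma2)%:R
    * (1 - exit_deficit B l1 (1%:M - inside_mx Gamma1) i 0).
Proof.
rewrite /joint_laplace /transient col_mxEu /laplace_vector.
move: (killed_solution _ _ _ _ _) (exit_deficit _ l1 _) (exit_deficit _ l2 _).
move=> w v1 v2.
have subE (v : 'cV[R]_n) : (const_mx 1 - v) i 0 = 1 - v i 0 by rewrite !mxE.
by rewrite mxE [X in X + _]mxE !inside_mul !subE.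
Qed.

Lemma exit_deficit0 (H : 'M[R]_n) : exit_deficit B 0 H = 0.
Proof. by rewrite /exit_deficit scale0r. Qed.

(** For positive [l1] and [l2] only [absorbing n] has rate 0; the rest concerns vanishing
    parameters. On Gamma_1 the rate is [l2], and the deficit of a zero parameter is 0; Gamma_2 is
    symmetric. Outside both sets [l1] = [l2] = 0, and the killed solution is B^-1 B H2 H1 1 = H2 H1
    1. *)
Lemma joint_laplace_rate0 x :
  discount_rate Gamma1 Gamma2 l1 l2 x = 0 -> joint_laplace x 0 = 1.
Proof.
rewrite /discount_rate; case: (split_ordP x) => i ->; last first.
  by rewrite /joint_laplace col_mxEd mxE.
rewrite -/(transient i) joint_laplace_transient.
have [i1|i1] := boolP (transient i \in Gamma1).
  have -> : transient i \in Gamma2 = false.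
    by apply/negP; exact: transient_disjoint.
  rewrite /= mulr0 add0r mulr1 => e2; rewrite killed_solution_eq0 ?i1 // e2.
  by rewrite exit_deficit0 /= mul0r addr0 add0r mul1r mxE subr0.
have [i2|i2] := boolP (transient i \in Gamma2).
  rewrite /= mulr0 addr0 mulr1 => e1.
  rewrite killed_solution_eq0 ?i2 ?orbT // e1.
  by rewrite exit_deficit0 /= mul0r addr0 add0r mul1r mxE subr0.
rewrite /= !mulr1 !mul0r !addr0 => /eqP; rewrite paddr_eq0 // => /andP[/eqP e1 /eqP e2].
rewrite /killed_solution /killed_source e1 e2 !exit_deficit0 !mulmx0 !addr0 sub0r.
rewrite raddf0 sub0r -mulNmx mulKmx; last first.
  by have := killed_resolvent_unitmx (lexx 0); rewrite raddf0 sub0r.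
by rewrite -!outside_mxE !outside_mul i1 i2 mxE !mulr1.
Qed.

End GeneratorForm.

(** Outside both sets this is the [s]-average of [joint_laplace]. At a state of a closed set the
    killed solutions vanish and the value is 1, whereas [joint_laplace] there still discounts the
    other exit. *)
Lemma laplace_formulaE (R : realType) (n m : nat) (B : 'I_m -> 'M[R]_n)
    (s : 'I_m -> 'I_n -> R) (Gamma1 Gamma2 : {set 'I_(n + 1)}) (l1 l2 : R) (i : 'I_n) :
  (forall k, l1%:M - B k \in unitmx) -> (forall k, l2%:M - B k \in unitmx) ->
  laplace_formula B (fun k => diag_mx (\row_j s k j)) (outside_mx Gamma1)
    (outside_mx Gamma2) l1 l2 i
  = \sum_k s k i * killed_solution (B k) (inside_mx Gamma1) (inside_mx Gamma2) l1 l2 i 0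
    + (1 - ((transient i \notin Gamma1) && (transient i \notin Gamma2))%:R).
Proof.
move=> u1 u2; rewrite /laplace_formula; congr (_ + (1 - _)); last first.
  rewrite -!mulmxA -rowE mxE !outside_mul mxE mulr1 -natrM mulnb andbC.
  by [].
rewrite summxE; apply: eq_bigr => k _.
have eS : delta_mx 0 i *m diag_mx (\row_j s k j) = s k i *: delta_mx 0 i :> 'rV[R]_n.
  apply/rowP => j; rewrite mul_mx_diag !mxE eqxx /= mulrC.
  by case: eqVneq => [->|_]; rewrite ?mulr1 ?mulr0.
rewrite !outside_mxE /killed_solution -laplace_source_eq // eS -!scalemxAl.
by rewrite [LHS]mxE -!mulmxA -rowE [X in _ * X]mxE.
Qed.

(** * Expansions of exponentials *)

Lemma iter_mulmx_bound (R : realType) (n k : nat) (A : 'M[R]_n) (b : R) i j :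
  (forall i j, `|A i j| <= b) ->
  `|(iter k (mulmx A) 1%:M) i j| <= (n%:R * b) ^+ k.
Proof.
move=> Ab; elim: k i j => [|k IH] i j /=.
  by rewrite mxE expr0; case: eqVneq; rewrite ?normr1 ?normr0.
have b_ge0 : 0 <= b by apply: le_trans (Ab i j).
rewrite mxE (le_trans (ler_norm_sum _ _ _)) // exprS.
have -> : n%:R * b * (n%:R * b) ^+ k = \sum_(l < n) (b * (n%:R * b) ^+ k).
  by rewrite sumr_const card_ord -mulrnAl mulr_natl.
by apply: ler_sum => l _; rewrite normrM ler_pM.
Qed.

(** From order 2 on, h ^+ k <= h ^+ 2 because h <= 1, so the tail is dominated by h ^+ 2 times the
    exponential series of [a], which bounds the growth of the powers of Q. Hence C = exp a. *)
Lemma expmx_expansion (R : realType) (n : nat) (Q : 'M[R]_n) :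
  exists2 C : R, 0 <= C & forall (h : R) (x y : 'I_n), 0 <= h -> h <= 1 ->
    `|expmx (h *: Q) x y - (x == y)%:R - h * Q x y| <= C * h ^+ 2.
Proof.
pose b := \sum_i \sum_j `|Q i j|; pose a := n%:R * b.
have b_ge0 : 0 <= b by apply: sumr_ge0 => i _; apply: sumr_ge0.
have a_ge0 : 0 <= a by rewrite mulr_ge0.
have Qb i j : `|Q i j| <= b.
  rewrite /b (bigD1 i) //= (bigD1 j) //= -addrA lerDl addr_ge0 ?sumr_ge0 //.
  by move=> k _; exact: sumr_ge0.
exists (expR a) => [|h x y h_ge0 h_le1]; first exact: expR_ge0.
pose u (k : nat) : R := (k`!%:R)^-1 * (iter k (mulmx (h *: Q)) 1%:M) x y.
have u_bound k : `|u k| <= h ^+ k * exp_coeff a k.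
  rewrite /u normrM ger0_norm ?invr_ge0 // mulrC /exp_coeff /= mulrA.
  apply: ler_wpM2r; first by rewrite invr_ge0.
  rewrite -exprMn mulrCA; apply: iter_mulmx_bound => i j.
  by rewrite mxE normrM ger0_norm // ler_wpM2l.
have hk_le1 k : h ^+ k <= 1 by apply: exprn_ile1.
have cu : cvgn (series u).
  apply: normed_cvg; apply: series_le_cvg (is_cvg_series_exp_coeff a) => k.
  - exact: normr_ge0.
  - exact: exp_coeff_ge0.
  - by apply: le_trans (u_bound k) _; rewrite ler_piMl // exp_coeff_ge0.
have -> : expmx (h *: Q) x y = limn (series u) by rewrite mxE.
have lim_norm : (fun N => `|series u N - (x == y)%:R - h * Q x y|) @ \oo
    --> `|limn (series u) - (x == y)%:R - h * Q x y|.
  apply: cvg_norm; apply: cvgB; last exact: cvg_cst.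
  by apply: cvgB; [exact: cu | exact: cvg_cst].
rewrite -(cvg_lim _ lim_norm) //; apply: limr_le; first exact: cvgP lim_norm.
near=> N.
have /subnK <- : (2 <= N)%N by near: N; exists 2%N.
move: (N - 2)%N => M; rewrite addn2.
rewrite /series /= big_nat_recl // big_nat_recl //= /u /= invr1 !mul1r mxE mulmx1 mxE.
have cancel (c e f : R) : c + (e + f) - c - e = f by ring.
rewrite cancel.
apply: (le_trans (ler_norm_sum _ _ _)).
apply: (@le_trans _ _ (\sum_(0 <= k < M) h ^+ 2 * exp_coeff a k.+2)).
  apply: ler_sum => k _; apply: le_trans (u_bound k.+2) _.
  apply: ler_wpM2r; first exact: exp_coeff_ge0.
  by rewrite -addn2 exprD ler_piMl // exprn_ge0.
rewrite -mulr_sumr mulrC ler_wpM2r ?exprn_ge0 //.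
apply: (@le_trans _ _ (series (exp_coeff a) M.+2)).
  rewrite /series /= big_nat_recl // big_nat_recl //= addrA lerDr.
  by rewrite addr_ge0 // exp_coeff_ge0.
apply: nondecreasing_cvgn_le; last exact: is_cvg_series_exp_coeff.
by apply: nondecreasing_series => k _ _; exact: exp_coeff_ge0.
Unshelve. all: by end_near. Qed.

(** The upper bound comes from exp (- x) <= 1 / (1 + x) = 1 - x + x^2 / (1 + x). *)
Lemma expRN_expansion (R : realType) (x : R) : 0 <= x ->
  `|expR (- x) - (1 - x)| <= x ^+ 2.
Proof.
move=> x_ge0; have lb := expR_ge1Dx (- x); have ub := expR_ge1Dx x.
rewrite ger0_norm; last by rewrite subr_ge0.
have e1 : expR x * expR (- x) = 1 by rewrite -expRD subrr expR0.
have := expR_gt0 (- x); nra.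
Qed.

(** * Exit times and discounts *)

Section ExitTime.
Context {d : measure_display} {T : measurableType d} {R : realType} {N : nat}.
Context (X : R -> T -> 'I_N) (Gamma : {set 'I_N}).

Lemma exit_time_le t w : 0 <= t -> X t w \in Gamma ->
  (exit_time X Gamma w <= t%:E)%E.
Proof. by move=> t_ge0 tG; apply: ereal_inf_lbound; exists t. Qed.

Definition never_left w : Prop := forall s t : R, 0 <= s -> s <= t ->
  X s w \in Gamma -> X t w \in Gamma.

Lemma exit_time_ge t w : never_left w -> X t w \notin Gamma ->
  (t%:E <= exit_time X Gamma w)%E.
Proof.
move=> cl tG; apply: le_ereal_inf_tmp => _ [s [s_ge0 sG] <-]; rewrite lee_fin leNgt.
by apply: contra tG => /ltW st; exact: cl sG.
Qed.

Context (rX : forall (t : R) w, 0 <= t -> \forall u \near t^'+, X u w = X t w).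

(** Right-continuity provides some u > t with the same state; closedness then excludes any entry
    before u. Closedness alone gives only the weak inequality. *)
Lemma exit_time_gt t w : 0 <= t -> never_left w -> X t w \notin Gamma ->
  (t%:E < exit_time X Gamma w)%E.
Proof.
move=> t_ge0 cl tG.
have [u [tu eu]] : exists u, t < u /\ X u w = X t w.
  apply: (@filter_ex _ (t^'+)); near=> u; split; near: u.
    exact: nbhs_right_gt.
  exact: rX.
apply: (@lt_le_trans _ _ u%:E); first by rewrite lte_fin.
by apply: exit_time_ge => //; rewrite eu.
Unshelve. all: by end_near. Qed.

Context (mX : forall (t : R) x, 0 <= t -> measurable (event_at X t x)).

Lemma measurable_event_in t : 0 <= t -> measurable [set w | X t w \in Gamma].
Proof.
move=> t_ge0.
rewrite (_ : [set w | _] = \bigcup_(x in [set x | x \in Gamma]) event_at X t x).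
  by apply: fin_bigcup_measurable => // x _; exact: mX.
apply/seteqP; split => [w wG|w [x xG xE]]; first by exists (X t w).
by rewrite /= (xE : X t w = x).
Qed.

(** The exit occurs before r exactly when X lies in Gamma at some rational time in [0, r):
    right-continuity keeps X in Gamma shortly after a visit, where a rational time can be found. *)
Lemma measurable_exit_time : measurable_fun [set: T] (exit_time X Gamma).
Proof.
apply: (measurability _ (ErealGenInftyO.measurableE R)) => _ [_ [r ->] <-].
rewrite setTI (_ : _ @^-1` _ = \bigcup_(q : rat)
  (if (0 <= ratr q :> R) && (ratr q < r) then [set w | X (ratr q) w \in Gamma]
   else set0)).
  apply: bigcupT_measurable_rat => q; case: ifP => // /andP[q_ge0 _].
  exact: measurable_event_in.
apply/seteqP; split => w /=; rewrite in_itv /=; last first.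
  case=> q _; case: ifP => // /andP[q_ge0 qr] qG.
  by apply: le_lt_trans (exit_time_le q_ge0 qG) _; rewrite lte_fin.
move=> /ereal_inf_lt[_ [t [t_ge0 tG] <-]]; rewrite lte_fin => tr.
have := rX w t_ge0; rewrite near_withinE => /nbhs_ballP[e /= e_gt0 eX].
have : t < Num.min r (t + e) by rewrite lt_min tr ltrDl.
case/rat_in_itvoo => q; rewrite in_itv /= lt_min => /andP[tq /andP[qr qe]].
exists q => //; rewrite (le_trans t_ge0 (ltW tq)) qr /=.
by rewrite eX // /ball /= ltr_distlC; apply/andP; split => //; lra.
Qed.

End ExitTime.

Section Discount.
Context {R : realType}.
Implicit Types (l s h : R) (tau : \bar R).

(** For l >= 0 the positive part keeps the value in [0, 1], also for s beyond the exit, so that it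
    is integrable and can be bounded without comparing s with tau. For tau = +oo the convention 0 *
    oo = 0 gives 1 when l = 0. *)
Definition discount l s tau : R :=
  fine (expeR (- (l%:E * maxe 0 (tau - s%:E))))%E.

Lemma discount_fin l s r :
  discount l s r%:E = expR (- (l * Num.max 0 (r - s))).
Proof. by rewrite /discount -EFinB -EFin_max. Qed.

Lemma discount_y l s : 0 <= l -> discount l s +oo%E = (l == 0)%:R.
Proof.
move=> l_ge0; rewrite /discount addye // max_r ?leey //.
case: eqVneq => [->|l_neq0]; first by rewrite mul0e oppe0 /= expR0.
by rewrite gt0_muley // lte_fin lt_def l_neq0.
Qed.

Lemma discount_Ny l s : discount l s -oo%E = 1.
Proof. by rewrite /discount addNye max_l ?leNye // mule0 oppe0 /= expR0. Qed.

Lemma discount_ge0 l s tau : 0 <= discount l s tau.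
Proof. by rewrite fine_ge0 // expeR_ge0. Qed.

Lemma discount0 s tau : discount 0 s tau = 1.
Proof. by rewrite /discount mul0e oppe0 /= expR0. Qed.

Lemma discount_le1 l s tau : 0 <= l -> discount l s tau <= 1.
Proof.
move=> l_ge0; case: tau => [r||]; rewrite ?discount_Ny //.
  by rewrite discount_fin expR_le1 oppr_le0 mulr_ge0 // le_max lexx.
by rewrite discount_y //; case: eqVneq.
Qed.

Lemma discount_past l s tau : (tau <= s%:E)%E -> discount l s tau = 1.
Proof.
case: tau => [r||] //; rewrite ?discount_Ny // lee_fin => rs.
by rewrite discount_fin max_l ?subr_le0 // mulr0 oppr0 expR0.
Qed.

Lemma discount_shift_le l s h tau : 0 <= l -> 0 <= h ->
  discount l s tau <= discount l (s + h) tau.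
Proof.
move=> l_ge0 h_ge0; case: tau => [r||]; rewrite ?discount_Ny ?discount_y //.
rewrite !discount_fin ler_expR lerN2 ler_wpM2l //.
by rewrite ge_max !le_max lexx /=; apply/orP; right; lra.
Qed.

Lemma discount_shift_ge l s h tau : 0 <= l -> 0 <= h ->
  expR (- (l * h)) * discount l (s + h) tau <= discount l s tau.
Proof.
move=> l_ge0 h_ge0; case: tau => [r||]; rewrite ?discount_Ny ?discount_y //.
- rewrite !discount_fin -expRD ler_expR -opprD lerN2 -mulrDr ler_wpM2l //.
  rewrite ge_max addr_ge0 ?le_max ?lexx //=.
  by rewrite -lerBlDl le_max; apply/orP; right; lra.
- by rewrite ler_piMl // expR_le1 oppr_le0 mulr_ge0.
- by rewrite mulr1 expR_le1 oppr_le0 mulr_ge0.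
Qed.

Lemma discount_shift l s h tau : 0 <= l -> 0 <= h -> ((s + h)%:E <= tau)%E ->
  discount l s tau = expR (- (l * h)) * discount l (s + h) tau.
Proof.
move=> l_ge0 h_ge0; case: tau => [r||] //; last first.
  rewrite !discount_y // => _.
  by case: eqVneq => [->|_]; rewrite ?mulr0 // mul0r oppr0 expR0 mulr1.
rewrite lee_fin => shr; rewrite !discount_fin -expRD -opprD -mulrDr.
by rewrite !max_r ?subr_ge0 //; [congr (expR (- (_ * _))); ring | lra].
Qed.

Lemma measurable_expeR : measurable_fun setT (@expeR R).
Proof.
rewrite (_ : @expeR R = fun x => if x == +oo%E then +oo%E
  else if x == -oo%E then 0%E else (expR (fine x))%:E); last first.
  by apply/funext => -[].
apply: measurable_fun_ifT; [exact: measurable_fun_eqe | by [] |].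
apply: measurable_fun_ifT; [exact: measurable_fun_eqe | by [] |].
apply/measurable_EFinP; apply: (measurableT_comp (@measurable_expR R)).
exact: fine_measurable.
Qed.

Lemma measurable_discount (d : measure_display) (T : measurableType d) l s
    (tau : T -> \bar R) :
  measurable_fun [set: T] tau -> measurable_fun [set: T] (fun w => discount l s (tau w)).
Proof.
move=> mtau; apply: (measurableT_comp (fine_measurable measurableT)).
apply: (measurableT_comp measurable_expeR).
apply: measurableT_comp => //; apply: measurable_funeM.
apply: measurable_maxe => //; exact: emeasurable_funB.
Qed.

Lemma measurable_laplace_exp (d : measure_display) (T : measurableType d)
    (t l1 l2 : R) (tau1 tau2 : T -> \bar R) :
  measurable_fun [set: T] tau1 -> measurable_fun [set: T] tau2 ->
  measurable_fun [set: T] (laplace_exp t l1 l2 tau1 tau2).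
Proof.
move=> m1 m2; apply: (measurableT_comp measurable_expeR).
apply: measurableT_comp => //.
by apply: emeasurable_funD; apply: measurable_funeM; exact: emeasurable_funB.
Qed.

(** With both exits pending the positive parts are inactive, and both terms of the exponent are
    nonnegative, so no oo - oo arises when the exponential is split. *)
Lemma laplace_exp_pending (d : measure_display) (T : measurableType d) (t l1 l2 : R)
    (tau1 tau2 : T -> \bar R) w :
  0 <= l1 -> 0 <= l2 -> both_pending t tau1 tau2 w ->
  laplace_exp t l1 l2 tau1 tau2 w
  = (discount l1 t (tau1 w) * discount l2 t (tau2 w))%:E.
Proof.
move=> l1_ge0 l2_ge0 /andP[t1 t2]; rewrite EFinM.
have discE l tau : 0 <= l -> (t%:E < tau)%E ->
    expeR (- (l%:E * (tau - t%:E)))%E = (discount l t tau)%:E.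
  move=> l_ge0; case: tau => [r||] //.
    by rewrite lte_fin discount_fin => tr; rewrite max_r ?subr_ge0 // ltW.
  move=> _; rewrite discount_y // addye //.
  case: eqVneq => [->|l_neq0]; first by rewrite mul0e oppe0 /= expR0.
  by rewrite gt0_muley // lte_fin lt_def l_neq0.
rewrite -!discE // -expeRD /laplace_exp oppeD // ge0_adde_def // inE mule_ge0 ?lee_fin //.
- by rewrite sube_ge0 ?ltW.
- by rewrite sube_ge0 ?ltW.
Qed.

End Discount.

(** * Error propagation *)

(** Applying the step to elements near the infimum I yields I (1 - exp (- rho h)) <= C h^2. For I >
    0 the left side is of order h, which fails for small h. *)
Lemma contraction_inf_le0 (R : realType) (S : set R) (rho C : R) :
  0 < rho -> 0 <= C -> S !=set0 -> lbound S 0 ->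
  (forall h K, 0 <= h -> h <= 1 -> S K -> S (expR (- (rho * h)) * K + C * h ^+ 2)) ->
  inf S <= 0.
Proof.
move=> rho_gt0 C_ge0 S0 lbS stepS; rewrite leNgt; apply/negP => inf_gt0.
have hiS : has_lbound S by exists 0.
have bound h : 0 < h -> h <= 1 -> inf S * rho * (1 - rho * h) <= C * h.
  move=> h_gt0 h_le1; set q := expR (- (rho * h)).
  have q_gt0 : 0 < q by exact: expR_gt0.
  have : (inf S - C * h ^+ 2) / q <= inf S.
    apply: lb_le_inf => // K SK; rewrite ler_pdivrMr // lerBlDr mulrC.
    by apply: ge_inf => //; apply: stepS => //; exact: ltW.
  rewrite ler_pdivrMr // => infq.
  have rh_ge0 : 0 <= rho * h by rewrite mulr_ge0 ?ltW.
  have /ler_normlP[_ qub] := expRN_expansion rh_ge0; rewrite -/q in qub.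
  rewrite -(ler_pM2r h_gt0).
  have : inf S * (1 - q) <= C * h ^+ 2 by lra.
  have : inf S * (rho * h - (rho * h) ^+ 2) <= inf S * (1 - q).
    by apply: ler_wpM2l; lra.
  move=> e1 e2; rewrite -[leRHS]mulrA -expr2.
  apply: (le_trans _ e2); apply: (le_trans _ e1).
  by rewrite le_eqVlt; apply/orP; left; apply/eqP; ring.
pose c := inf S * rho; have c_gt0 : 0 < c by rewrite mulr_gt0.
(* The step size h = c / D then satisfies h <= 1 and (C + rho c) h < c, which contradicts
   [bound]. *)
pose D := C + rho * c + c + 1.
have rc_gt0 : 0 < rho * c by rewrite mulr_gt0.
have D_gt0 : 0 < D by rewrite /D; lra.
have cD : c / D <= 1 by rewrite ler_pdivrMr // mul1r /D; lra.
have := bound (c / D) (divr_gt0 c_gt0 D_gt0) cD; rewrite -/c.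
have -> : c * (1 - rho * (c / D)) = c - rho * c * (c / D) by ring.
apply/negP; rewrite -ltNge ltrBrDr -mulrDl mulrCA -[ltRHS]mulr1 ltr_pM2l //.
by rewrite ltr_pdivrMr // mul1r /D; lra.
Qed.

Section FeynmanKac.
Context {R : realType} {N : nat}.
Context (Q : 'M[R]_N) (F r : 'I_N -> R) (L : R).
Context (L_ge0 : 0 <= L) (r_ge0 : forall x, 0 <= r x) (r_le : forall x, r x <= L).
Context (FK : forall x, \sum_y Q x y * F y = r x * F x).

Lemma expmx_offdiag : exists2 C : R, 0 <= C &
  forall h x y, 0 <= h -> h <= 1 -> x != y -> `|expmx (h *: Q) x y| <= C * h.
Proof.
have [C C_ge0 QC] := expmx_expansion Q.
exists (C + \sum_i \sum_j `|Q i j|) => [|h x y h_ge0 h_le1 nxy].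
  by rewrite addr_ge0 ?sumr_ge0 // => i _; rewrite sumr_ge0.
have Qb : `|Q x y| <= \sum_i \sum_j `|Q i j|.
  rewrite (bigD1 x) //= (bigD1 y) //= -addrA lerDl addr_ge0 ?sumr_ge0 //.
  by move=> k _; exact: sumr_ge0.
have := QC h x y h_ge0 h_le1; rewrite (negPf nxy) subr0 => QCh.
rewrite -(subrK (h * Q x y) (expmx _ _ _)) (le_trans (ler_normD _ _)) //.
rewrite mulrDl lerD //; last by rewrite normrM ger0_norm // mulrC ler_wpM2r.
by apply: le_trans QCh _; rewrite ler_wpM2l // expr2 ler_piMl.
Qed.

(** First-order terms cancel: with a = h r x, the equation Q F = r F gives exp (h Q) F = (1 + a) F +
    O (h^2) at x, and exp (- a) (1 + a) = 1 + O (a^2). *)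
Lemma discounted_step : exists2 C : R, 0 <= C &
  forall h x, 0 <= h -> h <= 1 ->
  `|expR (- (r x * h)) * (\sum_y expmx (h *: Q) x y * F y) - F x| <= C * h ^+ 2.
Proof.
have [C C_ge0 QC] := expmx_expansion Q; pose M := \sum_y `|F y|.
have M_ge0 : 0 <= M by exact: sumr_ge0.
have FM x : `|F x| <= M by rewrite /M (bigD1 x) //= lerDl sumr_ge0.
(* The first term bounds (e' (1 + a) - a^2) F x, using |e'| <= a^2 and a <= L h with h <= 1; the
   second is the remainder of the matrix exponential applied to F. *)
exists (L ^+ 2 * (2 + L) * M + C * M) => [|h x h_ge0 h_le1].
  by rewrite addr_ge0 // !mulr_ge0 // addr_ge0.
pose e y := expmx (h *: Q) x y - (x == y)%:R - h * Q x y.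
pose E := \sum_y e y * F y.
have E_le : `|E| <= C * h ^+ 2 * M.
  rewrite (le_trans (ler_norm_sum _ _ _)) // /M mulr_sumr; apply: ler_sum => y _.
  by rewrite normrM ler_wpM2r //; exact: QC.
pose a := r x * h; have a_ge0 : 0 <= a by rewrite mulr_ge0.
have aLh : a <= L * h by rewrite ler_wpM2r.
have aL : a <= L by apply: le_trans aLh _; rewrite ler_piMr.
have -> : \sum_y expmx (h *: Q) x y * F y = (1 + a) * F x + E.
  have -> : (1 + a) * F x = \sum_y ((x == y)%:R * F y + h * (Q x y * F y)).
    rewrite big_split /= -mulr_sumr FK (bigD1 x) //= eqxx mul1r big1 => [|y nyx].
      by rewrite addr0 /a; ring.
    by rewrite eq_sym (negPf nyx) mul0r.
  by rewrite /E -big_split /=; apply: eq_bigr => y _; rewrite /e; ring.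
rewrite -/a; set q := expR (- a).
have q_ge0 : 0 <= q by exact: expR_ge0.
have q_le1 : q <= 1 by rewrite expR_le1 oppr_le0.
have := expRN_expansion a_ge0; rewrite -/q; set e' := q - (1 - a) => e'_le.
have -> : q * ((1 + a) * F x + E) - F x = (e' * (1 + a) - a ^+ 2) * F x + q * E.
  by rewrite /e'; ring.
rewrite [leRHS]mulrDl (le_trans (ler_normD _ _)) // lerD //; last first.
  rewrite normrM ger0_norm // (le_trans (ler_piMl _ q_le1)) //.
  by rewrite mulrAC.
rewrite normrM -[leRHS]mulrAC; apply: ler_pM => //.
apply: (@le_trans _ _ (a ^+ 2 * (2 + a))).
  rewrite (le_trans (ler_normB _ _)) // normrM (ger0_norm (_ : 0 <= 1 + a)) ?addr_ge0 //.
  rewrite (ger0_norm (exprn_ge0 2 a_ge0)).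
  have : `|e'| * (1 + a) <= a ^+ 2 * (1 + a) by rewrite ler_wpM2r ?addr_ge0.
  by lra.
rewrite [leRHS]mulrAC -exprMn; apply: ler_pM; rewrite ?exprn_ge0 ?addr_ge0 ?lerD2l //.
by rewrite lerXn2r // nnegrE mulr_ge0.
Qed.

End FeynmanKac.

(** * Joint Laplace transform in a fixed regime *)

Section History.
Context {d : measure_display} {T : measurableType d} {R : realType} {N : nat}.
Context (X : R -> T -> 'I_N).

Lemma historyI s (A B : set T) :
  history X s A -> history X s B -> history X s (A `&` B).
Proof.
set G := [set A | exists u x, 0 <= u <= s /\ A = event_at X u x].
exact: (@measurableI _ (g_sigma_algebraType G)).
Qed.

Lemma history_le s t : s <= t -> history X s `<=` history X t.
Proof.
move=> st; apply: sub_sigma_algebra2 => _ [u [x [/andP[u_ge0 us] ->]]].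
by exists u, x; rewrite u_ge0 (le_trans us).
Qed.

Lemma history_event s u x : 0 <= u -> u <= s -> history X s (event_at X u x).
Proof. by move=> u_ge0 us; apply: sub_sigma_algebra; exists u, x; rewrite u_ge0. Qed.

Lemma strict_history_sub s : strict_history X s `<=` history X s.
Proof.
apply: sub_sigma_algebra2 => _ [u [x [/andP[u_ge0 /ltW us] ->]]].
by exists u, x; rewrite u_ge0.
Qed.

Lemma history_measurable s (A : set T) :
  (forall t x, 0 <= t -> measurable (event_at X t x)) ->
  history X s A -> measurable A.
Proof.
move=> mX; apply: smallest_sub; first exact: sigma_algebra_measurable.
by move=> _ [u [x [/andP[u_ge0 _] ->]]]; exact: mX.
Qed.

End History.

Lemma Rintegral_fibers (d : measure_display) (T : measurableType d) (R : realType)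
    (mu : {measure set T -> \bar R}) (N : nat) (Z : T -> 'I_N) (E : set T) (f : T -> R) :
  measurable E -> (forall y, measurable [set w | Z w = y]) ->
  mu.-integrable E (EFin \o f) ->
  \int[mu]_(w in E) f w = \sum_y \int[mu]_(w in E `&` [set w | Z w = y]) f w.
Proof.
move=> mE mZ intf.
have consE y (s : seq 'I_N) :
    [set w | Z w \in y :: s] = [set w | Z w = y] `|` [set w | Z w \in s].
  apply/seteqP; split=> w /=; rewrite in_cons; first by move/predU1P.
  by move=> ?; apply/predU1P.
have mZs (s : seq 'I_N) : measurable [set w | Z w \in s].
  elim: s => [|y s IH]; last by rewrite consE; exact: measurableU.
  by rewrite (_ : [set _ | _] = set0) //; apply/seteqP; split=> w.
have split_seq (s : seq 'I_N) : uniq s ->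
    \int[mu]_(w in E `&` [set w | Z w \in s]) f w
    = \sum_(y <- s) \int[mu]_(w in E `&` [set w | Z w = y]) f w.
  elim: s => [_|y s IH /= /andP[ys us]].
    rewrite big_nil (_ : E `&` _ = set0) ?Rintegral_set0 //.
    by apply/seteqP; split => w // -[].
  rewrite big_cons -IH // consE setIUr Rintegral_setU //.
  - exact: measurableI.
  - exact: measurableI.
  - apply: integrableS intf => //; rewrite -setIUr; last exact: subIsetl.
    by apply: measurableI => //; exact: measurableU.
  - apply/eqP/seteqP; split => w //= [[_ Zy] [_ Zs]].
    by move: ys; rewrite -Zy Zs.
rewrite -split_seq ?index_enum_uniq //; congr (Rintegral _ _ _).
by apply/seteqP; split => w; [move=> Ew; split => //=; rewrite mem_index_enum | case].
Qed.

Section JointLaplace.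
Context {d : measure_display} {T : measurableType d} {R : realType}.
Context (P : probability T R) {N : nat} (D : set T) (X : R -> T -> 'I_N).
Context (Q : 'M[R]_N) (Gamma1 Gamma2 : {set 'I_N}) (l1 l2 : R) (F : 'I_N -> R).
Context (mD : measurable D) (hM : markov_jump_process P D X Q).
Context (l1_ge0 : 0 <= l1) (l2_ge0 : 0 <= l2).
Context (cl1 : {ae P, forall w, never_left X Gamma1 w}).
Context (cl2 : {ae P, forall w, never_left X Gamma2 w}).

Local Notation r := (discount_rate Gamma1 Gamma2 l1 l2).

Context (FK : forall x, \sum_y Q x y * F y = r x * F x).
Context (F1 : forall x, r x = 0 -> F x = 1).

Let tau1 := exit_time X Gamma1.
Let tau2 := exit_time X Gamma2.

Definition joint_discount s w := discount l1 s (tau1 w) * discount l2 s (tau2 w).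

Let L := l1 + l2.

Let L_ge0 : 0 <= L. Proof. exact: addr_ge0. Qed.

Let r_ge0 x : 0 <= r x.
Proof. by rewrite addr_ge0 // mulr_ge0. Qed.

Let r_le x : r x <= L.
Proof. by apply: lerD; rewrite ler_piMr // lern1 leq_b1. Qed.

Let mX (t : R) x : 0 <= t -> measurable (event_at X t x).
Proof. by case: hM => _ mX _ _; exact: mX. Qed.

Let rX (t : R) w : 0 <= t -> \forall u \near t^'+, X u w = X t w.
Proof. by case: hM => _ _ rX _; exact: rX. Qed.

Lemma joint_discount_ge0 s w : 0 <= joint_discount s w.
Proof. by rewrite mulr_ge0 ?discount_ge0. Qed.

Lemma joint_discount_le1 s w : joint_discount s w <= 1.
Proof. by rewrite mulr_ile1 ?discount_ge0 ?discount_le1. Qed.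

Lemma measurable_joint_discount s : measurable_fun [set: T] (joint_discount s).
Proof.
by apply: measurable_funM; apply: measurable_discount; exact: measurable_exit_time.
Qed.

Lemma integrable_joint_discount s E : measurable E ->
  P.-integrable E (EFin \o joint_discount s).
Proof.
move=> mE; apply: measurable_bounded_integrable => //.
- by apply: le_lt_trans (probability_le1 _ _) _; rewrite ?ltry.
- exact: measurable_funS (measurable_joint_discount s).
- exists 1; split => // M M1 w _ /=; apply: le_trans (ltW M1).
  by rewrite ger0_norm ?joint_discount_ge0 // joint_discount_le1.
Qed.

Lemma joint_discount_shift_le s h w : 0 <= h ->
  joint_discount s w <= joint_discount (s + h) w.
Proof.
by move=> h_ge0; apply: ler_pM; rewrite ?discount_ge0 ?discount_shift_le.
Qed.

Lemma joint_discount_shift_ge s h w : 0 <= h ->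
  expR (- (L * h)) * joint_discount (s + h) w <= joint_discount s w.
Proof.
move=> h_ge0; rewrite /L mulrDl opprD expRD /joint_discount mulrACA.
apply: ler_pM; rewrite ?mulr_ge0 ?expR_ge0 ?discount_ge0 //;
  exact: discount_shift_ge.
Qed.

(** If x lies in Gamma, both discounts are 1. Otherwise being in x at s + h excludes an earlier
    entry, so the exit is no earlier than s + h and the shift is exact. The path strictly between s
    and s + h is irrelevant. *)
Lemma discount_stay l (Gamma : {set 'I_N}) s h x w :
  0 <= l -> 0 <= s -> 0 <= h -> never_left X Gamma w ->
  X s w = x -> X (s + h) w = x ->
  discount l s (exit_time X Gamma w)
  = expR (- (l * (x \notin Gamma)%:R * h)) * discount l (s + h) (exit_time X Gamma w).
Proof.
move=> l_ge0 s_ge0 h_ge0 nl xs xh; have sh_ge0 : 0 <= s + h by exact: addr_ge0.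
have [xG|xG] := boolP (x \in Gamma).
  rewrite mulr0 mul0r oppr0 expR0 mul1r !discount_past //.
    by apply: exit_time_le; rewrite // xh.
  by apply: exit_time_le; rewrite // xs.
by rewrite mulr1; apply: discount_shift => //; apply: exit_time_ge; rewrite // xh.
Qed.

Lemma joint_discount_stay s h x w : 0 <= s -> 0 <= h ->
  never_left X Gamma1 w -> never_left X Gamma2 w ->
  X s w = x -> X (s + h) w = x ->
  joint_discount s w = expR (- (r x * h)) * joint_discount (s + h) w.
Proof.
move=> s_ge0 h_ge0 nl1 nl2 xs xh; rewrite /joint_discount.
rewrite (discount_stay l1_ge0 s_ge0 h_ge0 nl1 xs xh).
rewrite (discount_stay l2_ge0 s_ge0 h_ge0 nl2 xs xh).
by rewrite mulrACA -expRD /discount_rate mulrDl opprD.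
Qed.

Lemma joint_discount_rate0 s x w : 0 <= s -> X s w = x -> r x = 0 ->
  joint_discount s w = 1.
Proof.
have disc1 l (Gamma : {set 'I_N}) : 0 <= s -> X s w = x ->
    l * (x \notin Gamma)%:R = 0 -> discount l s (exit_time X Gamma w) = 1.
  move=> s_ge0 xs; have [xG _|xG] := boolP (x \in Gamma).
    by apply: discount_past; apply: exit_time_le; rewrite // xs.
  by rewrite mulr1 => ->; rewrite discount0.
rewrite /discount_rate => s_ge0 xs /eqP.
rewrite paddr_eq0 ?mulr_ge0 // => /andP[/eqP e1 /eqP e2].
by rewrite /joint_discount !disc1 // mulr1.
Qed.

Definition cell s x (A : set T) : set T := D `&` A `&` event_at X s x.

Local Notation p E := (fine (P E)).

Let p_ge0 E : 0 <= p E. Proof. by rewrite fine_ge0. Qed.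

Lemma measurable_cell s x A : 0 <= s -> history X s A -> measurable (cell s x A).
Proof.
move=> s_ge0 hA; apply: measurableI; last exact: mX.
by apply: measurableI => //; exact: history_measurable hA.
Qed.

Lemma Rintegral_joint_discount_le s E : measurable E ->
  \int[P]_(w in E) joint_discount s w <= p E.
Proof.
move=> mE; rewrite -[leRHS]mul1r -(Rintegral_cst P mE).
apply: le_Rintegral => // [||w _]; last exact: joint_discount_le1.
  exact: integrable_joint_discount.
apply: measurable_bounded_integrable => //.
- by apply: le_lt_trans (probability_le1 _ _) _; rewrite ?ltry.
- by exists 1; split => // M M1 w _ /=; rewrite normr1 ltW.
Qed.

Lemma prob_fibers s E : 0 <= s -> measurable E ->
  p E = \sum_y p (E `&` event_at X s y).
Proof.
move=> s_ge0 mE; have mZ y : measurable [set w | X s w = y] by exact: mX.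
have int1 : P.-integrable E (EFin \o (fun=> 1 : R)).
  apply: measurable_bounded_integrable => //.
  - by apply: le_lt_trans (probability_le1 _ _) _; rewrite ?ltry.
  - by exists 1; split => // M M1 w _ /=; rewrite normr1 ltW.
have := Rintegral_fibers mE mZ int1; rewrite Rintegral_cst // mul1r => ->.
apply: eq_bigr => y _; rewrite Rintegral_cst ?mul1r //; exact: measurableI.
Qed.

Definition laplace_error s x A : R :=
  \int[P]_(w in cell s x A) joint_discount s w - p (cell s x A) * F x.

(** One step replaces (s, x, A) by (s + h, y, A [&] {X_s = x}); uniformity over times, states and
    past events lets the same K be used again there. Scaling by the probability of the cell avoids
    conditioning on null events and makes the bounds add up over y. *)
Definition error_bound (K : R) : Prop := 0 <= K /\
  forall s x A, 0 <= s -> history X s A ->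
    `|laplace_error s x A| <= K * p (cell s x A).

Lemma error_bound_ex : exists K, error_bound K.
Proof.
exists (1 + \sum_y `|F y|); split=> [|s x A s_ge0 hA].
  by rewrite addr_ge0 // sumr_ge0.
have mC := measurable_cell x s_ge0 hA.
rewrite /laplace_error (le_trans (ler_normB _ _)) // mulrDl mul1r lerD //.
  rewrite ger0_norm ?Rintegral_joint_discount_le //.
  by apply: Rintegral_ge0 => w _; exact: joint_discount_ge0.
rewrite normrM ger0_norm // mulrC ler_wpM2r //.
by rewrite (bigD1 x) //= lerDl sumr_ge0.
Qed.

Lemma error_rate0 s x A : 0 <= s -> history X s A -> r x = 0 ->
  laplace_error s x A = 0.
Proof.
move=> s_ge0 hA rx0; have mC := measurable_cell x s_ge0 hA.
rewrite /laplace_error F1 // mulr1 (eq_Rintegral _ (g := fun=> 1)) => [|w].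
  by rewrite Rintegral_cst // mul1r subrr.
by rewrite inE => -[_ xs]; rewrite (joint_discount_rate0 s_ge0 xs).
Qed.

Lemma prob_step s h x y A : 0 <= s -> 0 <= h -> history X s A ->
  p (cell s x A `&` event_at X (s + h) y) = p (cell s x A) * expmx (h *: Q) x y.
Proof.
move=> s_ge0 h_ge0 hA; have [_ _ _ mk] := hM.
rewrite /cell mk ?lerDl // addrAC subrr add0r fineM //.
by rewrite fin_num_measure //; exact: measurable_cell.
Qed.

(* Discounting at the rate of x between s and s + h is exact, up to null sets, on
   paths with X_s = X_(s + h) = x, and costs O(h) on the others, which have
   probability O(h). *)
Lemma cell_step_error s h x y A E : 0 <= s -> 0 <= h -> history X s A ->
  E = cell s x A `&` event_at X (s + h) y ->
  `|\int[P]_(w in E) joint_discount s w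
    - expR (- (r x * h)) * \int[P]_(w in E) joint_discount (s + h) w|
  <= L * h * (x != y)%:R * p E.
Proof.
move=> s_ge0 h_ge0 hA EE; have sh_ge0 : 0 <= s + h by exact: addr_ge0.
have mE : measurable E.
  by rewrite EE; apply: measurableI; [exact: measurable_cell | exact: mX].
have int t := integrable_joint_discount t mE.
rewrite -RintegralZl //.
have [xy|nxy] := eqVneq x y.
  rewrite mulr0 mul0r normr_le0 subr_eq0; apply/eqP; congr fine.
  apply: ae_eq_integral => //.
  - exact: measurable_int (int s).
  - apply/measurable_EFinP; apply: measurable_funM => //.
    exact: measurable_funS (measurable_joint_discount (s + h)).
  - apply: filterS2 cl1 cl2 => w nl1 nl2; rewrite EE => -[[_ xs] xh].
    by congr EFin; apply: joint_discount_stay => //; rewrite xh.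
rewrite mulr1 RintegralZl //.
set I := Rintegral _ _ _; set J := Rintegral _ _ _; set q := expR _.
have J_ge0 : 0 <= J by apply: Rintegral_ge0 => w _; exact: joint_discount_ge0.
have J_le : J <= p E by exact: Rintegral_joint_discount_le.
have I_le : I <= J by apply: le_Rintegral => // w _; exact: joint_discount_shift_le.
have I_ge : expR (- (L * h)) * J <= I.
  rewrite -RintegralZl //; apply: le_Rintegral => // [|w _].
    exact: (integrableZl mE _ (int (s + h))).
  exact: joint_discount_shift_ge.
have q_le1 : q <= 1 by rewrite expR_le1 oppr_le0 mulr_ge0.
have q_ge : expR (- (L * h)) <= q by rewrite ler_expR lerN2 ler_wpM2r.
have e_ge := expR_ge1Dx (- (L * h)).
have qJ_le : q * J <= J by rewrite ler_piMl.
have qJ_ge : expR (- (L * h)) * J <= q * J by rewrite ler_wpM2r.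
have eJ : (1 - L * h) * J <= expR (- (L * h)) * J by rewrite ler_wpM2r.
have LJ : L * h * J <= L * h * p E by rewrite ler_wpM2l // mulr_ge0.
by rewrite ler_norml; apply/andP; split; lra.
Qed.

Lemma error_bound_step : (exists rho, 0 < rho /\ forall x, r x = 0 \/ rho <= r x) ->
  exists rho C, [/\ 0 < rho, 0 <= C & forall h K, 0 <= h -> h <= 1 ->
    error_bound K -> error_bound (expR (- (rho * h)) * K + C * h ^+ 2)].
Proof.
case=> rho [rho_gt0 rho_le].
have [C1 C1_ge0 off] := expmx_offdiag Q.
have [C2 C2_ge0 step] := discounted_step L_ge0 r_ge0 r_le FK.
(* For each of the [N] target states y != x, the transition probability is at most [C1 * h] and the
   discount error at most [L * h]; [C2] is the constant of [discounted_step]. *)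
exists rho, (L * (N%:R * C1) + C2); split => // [|h K h_ge0 h_le1 [K_ge0 HK]].
  by rewrite addr_ge0 // !mulr_ge0.
have C_ge0 : 0 <= L * (N%:R * C1) + C2 by rewrite addr_ge0 // !mulr_ge0.
split=> [|s x A s_ge0 hA]; first by rewrite addr_ge0 ?mulr_ge0 ?expR_ge0 ?exprn_ge0.
have [rx0|rho_rx] := rho_le x.
  by rewrite error_rate0 // normr0 mulr_ge0 // addr_ge0 ?mulr_ge0 ?expR_ge0 ?exprn_ge0.
have sh_ge0 : 0 <= s + h by exact: addr_ge0.
pose E y := cell s x A `&` event_at X (s + h) y.
have mC := measurable_cell x s_ge0 hA.
have EE y : E y = cell (s + h) y (A `&` event_at X s x).
  by rewrite /E /cell !setIA.
have hA' : history X (s + h) (A `&` event_at X s x).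
  apply: historyI; last by apply: history_event; rewrite ?lerDl.
  by apply: (history_le _ hA); rewrite lerDl.
have pE y : p (E y) = p (cell s x A) * expmx (h *: Q) x y by exact: prob_step.
have sum_pE : p (cell s x A) = \sum_y p (E y) by exact: prob_fibers.
set q := expR (- (r x * h)).
pose I y := \int[P]_(w in E y) joint_discount s w.
pose J y := \int[P]_(w in E y) joint_discount (s + h) w.
(* Three sources of error: discounting over the step at the constant rate [r x], the inherited error
   at time s + h, and the defect of F under one discounted step. *)
have -> : laplace_error s x A = \sum_y (I y - q * J y)
    + q * (\sum_y laplace_error (s + h) y (A `&` event_at X s x))
    + p (cell s x A) * (q * (\sum_y expmx (h *: Q) x y * F y) - F x).
  have -> : laplace_error s x A = \sum_y I y - p (cell s x A) * F x.
    rewrite /laplace_error (Rintegral_fibers (Z := X (s + h))) // => [y|].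
      exact: mX.
    exact: integrable_joint_discount.
  have -> : \sum_y laplace_error (s + h) y (A `&` event_at X s x)
      = \sum_y J y - p (cell s x A) * \sum_y expmx (h *: Q) x y * F y.
    rewrite mulr_sumr -sumrB; apply: eq_bigr => y _.
    by rewrite /laplace_error -EE pE mulrA.
  by rewrite sumrB -mulr_sumr; ring.
have b1 : `|\sum_y (I y - q * J y)| <= L * (N%:R * C1) * h ^+ 2 * p (cell s x A).
  rewrite (le_trans (ler_norm_sum _ _ _)) //.
  have -> : L * (N%:R * C1) * h ^+ 2 * p (cell s x A)
      = \sum_(y < N) L * h * (C1 * h) * p (cell s x A).
    by rewrite sumr_const card_ord -[RHS]mulr_natl; ring.
  apply: ler_sum => y _.
  apply: le_trans (cell_step_error s_ge0 h_ge0 hA (erefl _)) _.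
  have [xy|nxy] := eqVneq x y; first by rewrite mulr0 mul0r !mulr_ge0.
  rewrite mulr1 -[leRHS]mulrA ler_wpM2l ?mulr_ge0 // pE mulrC ler_wpM2r //.
  exact: le_trans (ler_norm _) (off h x y h_ge0 h_le1 nxy).
have b2 : `|q * (\sum_y laplace_error (s + h) y (A `&` event_at X s x))|
    <= expR (- (rho * h)) * K * p (cell s x A).
  rewrite normrM ger0_norm ?expR_ge0 // -mulrA ler_pM ?expR_ge0 //.
    by rewrite ler_expR lerN2 ler_wpM2r.
  rewrite (le_trans (ler_norm_sum _ _ _)) // sum_pE mulr_sumr.
  by apply: ler_sum => y _; rewrite EE; exact: HK.
have b3 : `|p (cell s x A) * (q * (\sum_y expmx (h *: Q) x y * F y) - F x)|
    <= C2 * h ^+ 2 * p (cell s x A).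
  by rewrite normrM ger0_norm // mulrC ler_wpM2r //; exact: step.
rewrite (le_trans (ler_normD _ _)) // (le_trans (lerD (ler_normD _ _) (lexx _))) //.
by lra.
Qed.

Lemma rate_gap : exists rho, 0 < rho /\ forall x, r x = 0 \/ rho <= r x.
Proof.
(* The initial value 1 keeps the minimum positive when every rate is 0; capping rho at 1 only
   weakens the contraction. *)
exists (\big[Num.min/1]_(x | 0 < r x) r x); split=> [|x].
  by elim/big_ind: _ => // a b a_gt0 b_gt0; rewrite lt_min a_gt0.
have := r_ge0 x; rewrite le_eqVlt => /predU1P[<-|rx]; first by left.
by right; exact: bigmin_le_cond.
Qed.

Lemma Rintegral_joint_discount s x A : 0 <= s -> history X s A ->
  \int[P]_(w in cell s x A) joint_discount s w = p (cell s x A) * F x.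
Proof.
move=> s_ge0 hA.
have [rho [C [rho_gt0 C_ge0 step]]] := error_bound_step rate_gap.
have inf_le0 : inf [set K | error_bound K] <= 0.
  apply: (contraction_inf_le0 rho_gt0 C_ge0) step; first exact: error_bound_ex.
  by move=> K [].
apply/eqP; rewrite -subr_eq0 -normr_le0 -/(laplace_error s x A).
have [p0|p_neq0] := eqVneq (p (cell s x A)) 0.
  have [K [_ HK]] := error_bound_ex.
  by have := HK s x A s_ge0 hA; rewrite p0 mulr0.
have p_gt0 : 0 < p (cell s x A) by rewrite lt_def p_neq0 p_ge0.
(* Every admissible K is at least this quotient, which is thus at most their infimum. *)
have : `|laplace_error s x A| / p (cell s x A) <= 0.
  apply: le_trans inf_le0; apply: lb_le_inf; first exact: error_bound_ex.
  by move=> K [_ HK]; rewrite ler_pdivrMr //; exact: HK.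
by rewrite ler_pdivrMr // mul0r.
Qed.

End JointLaplace.

(** * Mixture *)

Section RegimeTrace.
Context {d : measure_display} {T : measurableType d} {R : realType} {N m : nat}.
Context (phi : T -> 'I_m) (Xk : 'I_m -> R -> T -> 'I_N) (k : 'I_m).

Lemma regime_event t x : regime phi k `&` event_at (mixture phi Xk) t x
  = regime phi k `&` event_at (Xk k) t x.
Proof.
by apply/seteqP; split=> w [pk xt]; split => //; move: xt;
  rewrite /event_at /= /mixture (pk : phi w = k).
Qed.

(** The Markov property of [Xk k] speaks of its own past, the theorem of the past of the mixture;
    both have the same trace on phi = k. The sets A with this property form a sigma-algebra that
    contains the generating events. *)
Lemma history_trace s A : history (mixture phi Xk) s A ->
  exists2 A', history (Xk k) s A' & regime phi k `&` A = regime phi k `&` A'.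
Proof.
pose M := [set A | exists2 A', history (Xk k) s A' &
  regime phi k `&` A = regime phi k `&` A'].
suff : history (mixture phi Xk) s `<=` M by apply.
have [s0 sC sU] : sigma_algebra setT (history (Xk k) s).
  exact: smallest_sigma_algebra.
apply: smallest_sub; last first.
  move=> _ [u [x [us ->]]]; exists (event_at (Xk k) u x); last exact: regime_event.
  by apply: sub_sigma_algebra; exists u, x.
split.
- by exists set0.
- move=> B [B' hB' eB]; exists (setT `\` B'); first exact: sC.
  have eqB w : regime phi k w -> B w = B' w.
    move=> pk; apply/propext; split=> b.
      have : (regime phi k `&` B) w by split.
      by rewrite eB => -[].
    have : (regime phi k `&` B') w by split.
    by rewrite -eB => -[].
  by apply/seteqP; split=> w [pk [_ nB]]; split=> //; split=> //; move: nB;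
    rewrite eqB.
- move=> B MB; have /choice[B' hB'] : forall n, exists B',
      history (Xk k) s B' /\ regime phi k `&` B n = regime phi k `&` B'.
    by move=> n; have [B' hB' eB] := MB n; exists B'.
  exists (\bigcup_n B' n).
    by apply: sU => n; have [] := hB' n.
  by rewrite !setI_bigcupr; apply: eq_bigcupr => n _; have [] := hB' n.
Qed.

End RegimeTrace.

Section Mixture.
Context {d : measure_display} {T : measurableType d} {R : realType}.
Context (P : probability T R) {n m : nat} (B : 'I_m -> 'M[R]_n).
Context (pi : 'I_n -> R) (s0 : 'I_m -> 'I_n -> R).
Context (phi : T -> 'I_m) (Xk : 'I_m -> R -> T -> 'I_(n + 1)).
Context (hX : markov_mixture P B pi s0 phi Xk).

(** A single process, with one history and one pair of exit times, then serves all regimes: only the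
    matrix depends on [k]. *)
Lemma mixture_markov_jump k :
  markov_jump_process P (regime phi k) (mixture phi Xk) (generator (B k)).
Proof.
have [iQ mXk _ mk] := mixture_markov hX k; split => //.
- move=> t x t_ge0.
  rewrite (_ : event_at _ t x =
      \bigcup_(j in [set: 'I_m]) (regime phi j `&` event_at (Xk j) t x)).
    apply: fin_bigcup_measurable => // j _; apply: measurableI.
      exact: (mixture_regime_measurable hX).
    by have [_ mXj _ _] := mixture_markov hX j; exact: mXj.
  apply/seteqP; split=> [w xw|w [j _ ]]; first by exists (phi w).
  by rewrite -regime_event => -[].
- by move=> t w t_ge0; have [_ _ rX _] := mixture_markov hX (phi w); exact: rX.
- move=> s u x y A s_ge0 su /(history_trace k)[A' hA' eA].
  have eAx : regime phi k `&` A `&` event_at (mixture phi Xk) s x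
      = regime phi k `&` A' `&` event_at (Xk k) s x.
    by rewrite eA setIAC regime_event setIAC.
  rewrite eAx -mk //; congr (P _).
  have sub : regime phi k `&` A' `&` event_at (Xk k) s x `<=` regime phi k.
    by move=> w [[]].
  by rewrite -[in LHS](setIidl sub) -setIA regime_event setIA (setIidl sub).
Qed.

End Mixture.

Lemma Rintegral_lincomb (d : measure_display) (T : measurableType d) (R : realType)
    (mu : {measure set T -> \bar R}) (I : Type) (E : set T) (f : I -> T -> R)
    (c : I -> R) (s : seq I) :
  measurable E -> (forall i, mu.-integrable E (EFin \o f i)) ->
  mu.-integrable E (EFin \o (fun w => \sum_(i <- s) f i w * c i)) /\
  \int[mu]_(w in E) (\sum_(i <- s) f i w * c i)
  = \sum_(i <- s) (\int[mu]_(w in E) f i w) * c i.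
Proof.
move=> mE intf; elim: s => [|i s [int_s IH]].
  split; last first.
    rewrite big_nil (eq_Rintegral _ (g := fun=> 0)) => [|w _]; last by rewrite big_nil.
    by rewrite Rintegral_cst // mul0r.
  by under eq_fun do rewrite big_nil; exact: integrable0.
have int_i : mu.-integrable E (EFin \o (fun w => f i w * c i)).
  exact: (integrableZr mE (c i) (intf i)).
split.
  under eq_fun do rewrite big_cons.
  exact: (integrableD mE int_i int_s).
rewrite big_cons -IH -RintegralZr // -RintegralD //.
by apply: eq_Rintegral => w _; rewrite big_cons.
Qed.

Lemma cond_expectation_ae (d : measure_display) (T : measurableType d) (R : realType)
    (P : probability T R) (G : set_system T) (D : set T) (Y Y' : T -> \bar R)
    (Z : T -> R) :
  measurable D -> G `<=` measurable -> measurable_fun [set: T] Y' ->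
  {ae P, forall w, D w -> Y w = Y' w} ->
  cond_expectation P G D Y Z -> cond_expectation P G D Y' Z.
Proof.
move=> mD mG mY' eqY [iY mZ iZ eqZ].
have mY'D : measurable_fun D Y' by exact: measurable_funS mY'.
have mYD : measurable_fun D Y by exact: measurable_int iY.
split=> // [|A GA].
  apply/integrableP; split=> //; move/integrableP : iY => [_].
  rewrite (ae_eq_integral (fun w => `|Y' w|)%E) //.
  - exact: measurableT_comp.
  - exact: measurableT_comp.
  - by apply: filterS eqY => w e Dw; rewrite e.
have mAD : measurable (A `&` D) by apply: measurableI => //; exact: mG.
rewrite -eqZ //; apply: ae_eq_integral => //.
- exact: measurable_funS mY'.
- exact: measurable_funS mYD.
- by apply: filterS eqY => w e [_ Dw]; rewrite e.
Qed.

Lemma integral_EFin_Rintegral (d : measure_display) (T : measurableType d) (R : realType)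
    (mu : {measure set T -> \bar R}) (E : set T) (f : T -> R) :
  measurable E -> mu.-integrable E (EFin \o f) ->
  (\int[mu]_(w in E) (f w)%:E)%E = (\int[mu]_(w in E) f w)%:E.
Proof. by move=> mE intf; rewrite /Rintegral fineK // integrable_fin_num. Qed.

Theorem theorem3p14 (d : measure_display) (T : measurableType d) (R : realType)
    (P : probability T R) (n m : nat)
    (B : 'I_m -> 'M[R]_n) (pi : 'I_n -> R) (s0 : 'I_m -> 'I_n -> R)
    (phi : T -> 'I_m) (Xk : 'I_m -> R -> T -> 'I_(n + 1))
    (hX : markov_mixture P B pi s0 phi Xk)
    (Gamma1 Gamma2 : {set 'I_(n + 1)})
    (hne1 : Gamma1 != finset.set0) (hne2 : Gamma2 != finset.set0)
    (hcl1 : stochastically_closed P B (mixture phi Xk) Gamma1)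
    (hcl2 : stochastically_closed P B (mixture phi Xk) Gamma2)
    (hcap : Gamma1 :&: Gamma2 = [set absorbing n]%SET)
    (hpi : forall i, transient i \notin Gamma1 -> transient i \notin Gamma2 ->
       pi i != 0) :
  let X := mixture phi Xk in
  let tau1 := exit_time X Gamma1 in
  let tau2 := exit_time X Gamma2 in
  let H1 : 'M[R]_n := outside_mx Gamma1 in
  let H2 : 'M[R]_n := outside_mx Gamma2 in
  forall (hpos : {ae P, forall w, (0 < tau1 w)%E /\ (0 < tau2 w)%E})
    (t : R) (ht : 0 <= t)
    (F : set_system T) (hF : sigma_algebra setT F)
    (hFX : F `<=` strict_history X t)
    (s : 'I_m -> 'I_n -> T -> R)
    (hs : forall k j, cond_expectation P F (event_at X t (transient j))
       (EFin \o \1_(regime phi k)) (s k j))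
    (l1 l2 : R) (hl1 : 0 <= l1) (hl2 : 0 <= l2) (i : 'I_n),
  let Ft_i := cond_expectation P F (event_at X t (transient i)) in
  let S := fun (w : T) (k : 'I_m) => diag_mx (\row_j s k j w) in
  let Psi := fun w : T => laplace_formula B (S w) H1 H2 l1 l2 i in
  ({ae P, forall w, X t w = transient i -> both_pending t tau1 tau2 w} ->
   Ft_i (laplace_exp t l1 l2 tau1 tau2) Psi) /\
  Ft_i (fun w => if both_pending t tau1 tau2 w
                 then laplace_exp t l1 l2 tau1 tau2 w else 1%E) Psi.
Proof.
move=> X tau1 tau2 H1 H2 _ t t_ge0 F hF hFX s hs l1 l2 l1_ge0 l2_ge0 i Ft_i S Psi.
have MJ := mixture_markov_jump hX.
(* [MJ] has to be instantiated at some regime; [phi point] provides one. *)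
have mX (u : R) x : 0 <= u -> measurable (event_at X u x).
  have [_ mixX _ _] : markov_jump_process P (regime phi (phi point)) X
    (generator (B (phi point))) by exact: MJ.
  exact: mixX.
have rX (u : R) w : 0 <= u -> \forall v \near u^'+, X v w = X u w.
  by have [_ _ rX _] := MJ (phi w); exact: rX.
have mphi k : measurable (regime phi k) by exact: (mixture_regime_measurable hX).
have uR k l : 0 <= l -> l%:M - B k \in unitmx.
  have [iQ _ _ _] := MJ k.
  exact: (killed_resolvent_unitmx (mixture_nonsingular hX k) iQ).
have hFh : F `<=` history X t by move=> A /hFX; exact: strict_history_sub.
have mF : F `<=` measurable.
  by move=> A /hFh; apply: history_measurable => u x; exact: mX.
set E := event_at X t (transient i).
have mE : measurable E by exact: mX.
have mtau1 : measurable_fun [set: T] tau1 by exact: measurable_exit_time.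
have mtau2 : measurable_fun [set: T] tau2 by exact: measurable_exit_time.
pose Y := @joint_discount _ T R _ X Gamma1 Gamma2 l1 l2 t.
have mY : measurable_fun [set: T] Y.
  exact: (measurable_joint_discount _ _ _ _ (MJ (phi point))).
(* A bounded real version of the variable in the second conclusion; the first conclusion follows
   from it by a change on a null set. *)
pose f w := if both_pending t tau1 tau2 w then Y w else 1.
have mf : measurable_fun [set: T] f.
  apply: measurable_fun_ifT => //.
  by apply: measurable_and; apply: measurable_fun_lte.
have f_ge0 w : 0 <= f w by rewrite /f; case: ifP => // _; exact: joint_discount_ge0.
have f_le1 w : f w <= 1.
  by rewrite /f; case: ifP => // _; exact: joint_discount_le1.
have if_ G : measurable G -> P.-integrable G (EFin \o f).
  move=> mG; apply: measurable_bounded_integrable => //.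
  - by apply: le_lt_trans (probability_le1 _ _) _; rewrite ?ltry.
  - exact: measurable_funS mf.
  - by exists 1; split => // M M1 w _ /=; rewrite ger0_norm // (le_trans _ (ltW M1)).
pose c k := killed_solution (B k) (inside_mx Gamma1) (inside_mx Gamma2) l1 l2 i 0.
pose b : R := 1 - ((transient i \notin Gamma1) && (transient i \notin Gamma2))%:R.
have PsiE : Psi = fun w => \sum_k s k i w * c k + b.
  by apply/funext => w; rewrite /Psi /S laplace_formulaE // => k; exact: uR.
have is_ k : P.-integrable E (EFin \o s k i) by have [] := hs k i.
have [int_sum _] := Rintegral_lincomb c (index_enum 'I_m) mE is_.
have intb G : measurable G -> P.-integrable G (EFin \o fun=> b).
  move=> mG; apply: measurable_bounded_integrable => //.
  - by apply: le_lt_trans (probability_le1 _ _) _; rewrite ?ltry.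
  - by exists `|b|; split => [|M M1 w _ /=]; [rewrite num_real | exact: ltW].
have intPsi : P.-integrable E (EFin \o Psi).
  rewrite PsiE; exact: (integrableD mE int_sum (intb E mE)).
have mPsi : preimage_set_system setT Psi measurable `<=` F.
  have <- : <<s F >> = F by exact: sigma_algebra_id.
  have ms k : @measurable_fun _ _ (g_sigma_algebraType F) R setT (s k i).
    move=> _ V mV; apply: sub_sigma_algebra; have [_ msk _ _] := hs k i.
    by apply: msk; exists V.
  have mPsiF : @measurable_fun _ _ (g_sigma_algebraType F) R setT Psi.
    rewrite PsiE; apply: measurable_funD => //; apply: measurable_sum => k.
    exact: measurable_funM.
  by move=> _ [V mV <-]; exact: mPsiF.
have fY : (fun w => if both_pending t tau1 tau2 w
    then laplace_exp t l1 l2 tau1 tau2 w else 1%E) = EFin \o f.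
  apply/funext => w; rewrite /f /=; case: ifP => // bp.
  by rewrite laplace_exp_pending.
have main : Ft_i (EFin \o f) Psi.
  split=> //; first exact: if_.
  move=> A FA; have mA : measurable A by exact: mF.
  have mAE : measurable (A `&` E) by exact: measurableI.
  have sub : A `&` E `<=` E by exact: subIsetr.
  rewrite !integral_EFin_Rintegral //; [|exact: integrableS intPsi | exact: if_].
  congr EFin.
  (* If i lies in one of the sets, an exit has occurred by time t on [E], so f is 1; the formula is
     1 as well, since all killed solutions vanish at i. *)
  have [inG|/norP[i1 i2]] := boolP ((transient i \in Gamma1) || (transient i \in Gamma2)).
    apply: eq_Rintegral => w; rewrite inE => -[_ Ew].
    rewrite PsiE /b big1 => [|k _]; last first.
      have [iQ _ _ _] := MJ k.
      by rewrite /c (killed_solution_eq0 (mixture_nonsingular hX k) iQ (hcl1.2 k)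
        (hcl2.2 k)) ?mulr0.
    rewrite -negb_or inG subr0 add0r /f ifF //; apply/negbTE.
    rewrite /both_pending negb_and -!leNgt; case/orP : inG => iG; apply/orP.
      by left; apply: exit_time_le; rewrite // (Ew : X t w = _).
    by right; apply: exit_time_le; rewrite // (Ew : X t w = _).
  (* Outside both sets, closedness and right-continuity make both exits pending almost surely on
     [E]. *)
  have -> : \int[P]_(w in A `&` E) f w = \int[P]_(w in A `&` E) Y w.
    congr fine; apply: ae_eq_integral => //.
    - by apply/measurable_EFinP; exact: measurable_funS mf.
    - by apply/measurable_EFinP; exact: measurable_funS mY.
    - apply: filterS2 (hcl1.1) (hcl2.1) => w nl1 nl2 [_ Ew] /=.
      rewrite /f ifT // /both_pending; apply/andP; split; apply: exit_time_gt => //;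
        by rewrite (Ew : X t w = _).
  have intY : P.-integrable (A `&` E) (EFin \o Y).
    exact: (integrable_joint_discount _ _ (MJ (phi point)) l1_ge0 l2_ge0).
  rewrite (Rintegral_fibers (Z := phi) mAE mphi intY).
  have isA k : P.-integrable (A `&` E) (EFin \o s k i) by exact: integrableS (is_ k).
  have [int_sumA sumA] := Rintegral_lincomb c (index_enum 'I_m) mAE isA.
  rewrite PsiE RintegralD //; last exact: intb.
  rewrite /b i1 i2 subrr Rintegral_cst // mul0r addr0 sumA; apply: eq_bigr => k _.
  (* Since A belongs to the past of t, its part in regime k is a cell, on which Y integrates to its
     probability times the killed solution at i. That probability is the integral of [s k i] over A
     [&] E, by the defining property of [s]. *)
  have -> : A `&` E `&` [set w | phi w = k] = cell (regime phi k) X t (transient i) A.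
    by rewrite /cell setIC setIA.
  have [iQ _ _ _] := MJ k.
  have uBk := mixture_nonsingular hX k.
  have harmonic := joint_laplace_harmonic uBk iQ (hcl1.2 k) (hcl2.2 k) hcap l1_ge0 l2_ge0.
  have rate0 := joint_laplace_rate0 uBk iQ (hcl1.2 k) (hcl2.2 k) hcap l1_ge0 l2_ge0.
  rewrite (Rintegral_joint_discount (mphi k) (MJ k) l1_ge0 l2_ge0 hcl1.1 hcl2.1
    harmonic rate0) //; last exact: hFh.
  rewrite joint_laplace_transient (negPf i1) (negPf i2) !mul0r !addr0; congr (_ * _).
  have [_ _ _ /(_ A FA)] := hs k i.
  rewrite integral_indic // integral_EFin_Rintegral // => e.
  by rewrite -[RHS]/(fine (_)%:E) -e /cell setIA.
rewrite fY; split=> // bp.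
apply: (cond_expectation_ae (Y := EFin \o f)) => //.
  exact: measurable_laplace_exp.
by apply: filterS bp => w bpw Ew; rewrite -fY /= bpw.
Qed.
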